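(* Let $T$ be a complete first-order theory in a countable relational vocabulary $\tau$, and suppose there are complete $\tau$-theories $\{T_n\}_{n\in\omega}$ (all having infinite models, as does $T$) such that for every $n$, $T\neq T_n$ but $T\cap\exists_n=T_n\cap\exists_n$. Then $\mathrm{Mod}(T)$ is $\boldsymbol\Pi^0_\omega$-complete. Moreover, for every $\boldsymbol\Pi^0_\omega$ set $P\subseteq 2^\omega$ there is a continuous function $f:2^\omega\to\mathrm{Mod}(\tau)$ such that $f(p)\models T$ for $p\in P$, and for each $p\notin P$, $f(p)\models T_n$ for some $n$.
   Context: $\mathrm{Mod}(\tau)\subseteq 2^\omega$ is the Polish space of atomic diagrams of $\tau$-structures with universe $\omega$; $\mathrm{Mod}(T)$ is the set of those which are models of $T$. $T\cap\exists_n$ denotes the set of $\exists_n$-sentences (prenex, $n$ alternating quantifier blocks starting with $\exists$) belonging to $T$ (theories are taken deductively closed). $\boldsymbol\Pi^0_\omega$ is the class of countable intersections of sets in $\bigcup_n\boldsymbol\Sigma^0_n$. $\Gamma$-complete means: in $\Gamma$, and every $\Gamma$ subset of $2^\omega$ Wadge reduces to it via a continuous map. *)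

(* Defs.v *)
From Stdlib Require Import List Arith Cantor.
Import ListNotations.

(* A countable relational vocabulary: relation symbols are (some) natural
   numbers; [voc r = Some k] means r is a k-ary relation symbol of tau,
   [voc r = None] means r is not a symbol of tau. *)
Definition vocabulary := nat -> option nat.

Inductive form : Type :=
| fEq  : nat -> nat -> form
| fRel : nat -> list nat -> form
| fNot : form -> form
| fAnd : form -> form -> form
| fOr  : form -> form -> form
| fEx  : nat -> form -> form
| fAll : nat -> form -> form.

Fixpoint wf (voc : vocabulary) (phi : form) : Prop :=
  match phi with
  | fEq _ _ => True
  | fRel r xs => voc r = Some (length xs)
  | fNot a => wf voc a
  | fAnd a b | fOr a b => wf voc a /\ wf voc b
  | fEx _ a | fAll _ a => wf voc a
  end.

Fixpoint free (x : nat) (phi : form) : Prop :=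
  match phi with
  | fEq i j => x = i \/ x = j
  | fRel _ xs => In x xs
  | fNot a => free x a
  | fAnd a b | fOr a b => free x a \/ free x b
  | fEx y a | fAll y a => x <> y /\ free x a
  end.

Definition sentence (voc : vocabulary) (phi : form) : Prop :=
  wf voc phi /\ forall x, ~ free x phi.

Fixpoint qf (phi : form) : Prop :=
  match phi with
  | fEq _ _ | fRel _ _ => True
  | fNot a => qf a
  | fAnd a b | fOr a b => qf a /\ qf b
  | fEx _ _ | fAll _ _ => False
  end.

(* Prenex classes: ExF n = exists_n (n alternating blocks, starting with
   an existential block), AllF n = forall_n; blocks may be empty and
   exists_0 = forall_0 = quantifier-free. *)
Inductive ExF : nat -> form -> Prop :=
| ExF_qf phi : qf phi -> ExF 0 phi
| ExF_lift n phi : AllF n phi -> ExF (S n) phi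
| ExF_ex n x phi : ExF (S n) phi -> ExF (S n) (fEx x phi)
with AllF : nat -> form -> Prop :=
| AllF_qf phi : qf phi -> AllF 0 phi
| AllF_lift n phi : ExF n phi -> AllF (S n) phi
| AllF_all n x phi : AllF (S n) phi -> AllF (S n) (fAll x phi).

Record structure : Type := {
  dom : Type;
  rel : nat -> list dom -> Prop }.

Definition upd {A : Type} (v : nat -> A) (x : nat) (a : A) : nat -> A :=
  fun y => if Nat.eqb y x then a else v y.

Fixpoint sat (M : structure) (v : nat -> dom M) (phi : form) : Prop :=
  match phi with
  | fEq i j => v i = v j
  | fRel r xs => rel M r (map v xs)
  | fNot a => ~ sat M v a
  | fAnd a b => sat M v a /\ sat M v b
  | fOr a b => sat M v a \/ sat M v b
  | fEx x a => exists d : dom M, sat M (upd v x d) a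
  | fAll x a => forall d : dom M, sat M (upd v x d) a
  end.

Definition model (M : structure) (T : form -> Prop) : Prop :=
  inhabited (dom M) /\ forall phi, T phi -> forall v, sat M v phi.

Definition complete_theory (voc : vocabulary) (T : form -> Prop) : Prop :=
  (forall phi, T phi -> sentence voc phi) /\
  (exists M, model M T) /\
  (forall phi, sentence voc phi -> T phi \/ T (fNot phi)) /\
  (forall phi, sentence voc phi ->
     (forall M, model M T -> forall v, sat M v phi) -> T phi).

Definition infinite_type (A : Type) : Prop :=
  ~ exists l : list A, forall a, In a l.

Definition has_infinite_model (T : form -> Prop) : Prop :=
  exists M, model M T /\ infinite_type (dom M).

Definition cantor := nat -> bool.

Definition agree (n : nat) (p q : cantor) : Prop :=
  forall i, i < n -> p i = q i.

Definition open_set (A : cantor -> Prop) : Prop :=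
  forall p, A p -> exists n, forall q, agree n p q -> A q.

(* Sigma n = boldface Sigma^0_n for n >= 1 (Sigma 0 is empty, unused);
   Sigma^0_(m+1) = countable unions of Pi^0_m sets, where Pi^0_m sets are
   complements of Sigma^0_m sets. *)
Fixpoint Sigma (n : nat) (A : cantor -> Prop) : Prop :=
  match n with
  | 0 => False
  | S m =>
      match m with
      | 0 => open_set A
      | S _ => exists B : nat -> cantor -> Prop,
                 (forall k, Sigma m (fun x => ~ B k x)) /\
                 (forall x, A x <-> exists k, B k x)
      end
  end.

Definition Pi (n : nat) (A : cantor -> Prop) : Prop :=
  Sigma n (fun x => ~ A x).

Definition PiOmega (A : cantor -> Prop) : Prop :=
  exists (B : nat -> cantor -> Prop) (lev : nat -> nat),
    (forall k, Sigma (lev k) (B k)) /\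
    (forall x, A x <-> forall k, B k x).

Definition continuous (f : cantor -> cantor) : Prop :=
  forall p k, exists n, forall q, agree n p q -> f q k = f p k.

Definition PiOmega_complete (A : cantor -> Prop) : Prop :=
  PiOmega A /\
  forall P : cantor -> Prop, PiOmega P ->
    exists f, continuous f /\ forall p, P p <-> A (f p).

(* Bijective coding of atomic facts R_r(a_1,...,a_k) (a_i in omega) by
   natural numbers via Cantor pairing. *)
Fixpoint code_list (l : list nat) : nat :=
  match l with
  | [] => 0
  | a :: l' => S (Cantor.to_nat (a, code_list l'))
  end.

Definition code (r : nat) (args : list nat) : nat :=
  Cantor.to_nat (r, code_list args).

(* p is (the atomic diagram of) a tau-structure with universe omega: only
   codes of genuine tau-atoms may be set. *)
Definition ModTau (voc : vocabulary) (p : cantor) : Prop :=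
  forall k, p k = true ->
    exists r args, voc r = Some (length args) /\ k = code r args.

Definition struct_of (p : cantor) : structure :=
  {| dom := nat; rel := fun r args => p (code r args) = true |}.

Definition ModT (voc : vocabulary) (T : form -> Prop) (p : cantor) : Prop :=
  ModTau voc p /\ model (struct_of p) T.

(* Main.v *)
From Stdlib Require Import List Arith Lia Cantor Classical ClassicalEpsilon.
From Stdlib Require Import FunctionalExtensionality PropExtensionality.
Require Import Defs.
Import ListNotations.

(** Write P as an intersection of Borel sets B_k of finite level. A system of
    true-stage relations [s <=_k t] (one for each k, computed from p restricted
    to t) makes each complement of B_k open along the true stages of some level.
    At stage u of the construction on input p we hold a guess at the final theory
    (T, or Ts (c+1) if stage c saw, at a level at most c, that p leaves some B_k)
    and a complete type of the guessed theory, of which finitely many variables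
    are committed. The type at u agrees on formulas of level k with the type at
    every [s <=_k u], k <= s. Such a type exists because the guesses at s and u
    agree on exists_(k+1)-sentences, and because quantifying away variables costs
    one level. At level 0 this makes the atomic diagram continuous in p; along
    ever truer stages the types converge to a complete Henkin type, which the
    structure satisfies. It extends T if p is in P, and some Ts n otherwise.
    Types are only required to be finitely satisfiable in infinite models, so the
    compactness theorem is not needed. *)

(** * Renaming and prenex forms *)

(** A declaration may turn out to be wrong after part of the structure has been built for the wrong
    theory, and atomic facts once fixed can never be withdrawn. The levels measure what must
    survive: a stage that is a predecessor at level [k] but not at level [k+1] still binds formulas
    of level [k], while its decisions about higher ones may be dropped. The indices make this budget
    close. Two stages from [k] on that are related at level [k] see the same declarations made
    before stage [k]; any other declaration is made at some [c >= k], and [Ts (c+1)] agrees with [T]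
    on exists_(k+1). This is one level more than the agreement wanted between the types, exactly the
    level lost when variables are quantified away. True stages generalize the nondeficiency stages
    of an enumeration: a stage is true when no later one acts with a smaller number. *)

Lemma upd_eq {A : Type} (v : nat -> A) (x : nat) (a : A) : upd v x a x = a.
Proof. unfold upd. now rewrite Nat.eqb_refl. Qed.

Lemma upd_neq {A : Type} (v : nat -> A) (x y : nat) (a : A) :
  y <> x -> upd v x a y = v y.
Proof. intros H. unfold upd. now rewrite (proj2 (Nat.eqb_neq y x) H). Qed.

Lemma sat_ext (M : structure) (phi : form) : forall v w,
  (forall x, free x phi -> v x = w x) -> sat M v phi <-> sat M w phi.
Proof.
  induction phi; simpl; intros v w H.
  - rewrite (H n), (H n0) by auto. tauto.
  - replace (map w l) with (map v l) by (apply map_ext_in; auto). tauto.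
  - rewrite (IHphi v w H). tauto.
  - rewrite (IHphi1 v w), (IHphi2 v w) by auto. tauto.
  - rewrite (IHphi1 v w), (IHphi2 v w) by auto. tauto.
  - assert (E : forall d, sat M (upd v n d) phi <-> sat M (upd w n d) phi).
    { intros d. apply IHphi. intros x Hx. destruct (Nat.eq_dec x n) as [->|Hn].
      - now rewrite !upd_eq.
      - rewrite !upd_neq by auto. auto. }
    split; intros [d Hd]; exists d; now apply E.
  - assert (E : forall d, sat M (upd v n d) phi <-> sat M (upd w n d) phi).
    { intros d. apply IHphi. intros x Hx. destruct (Nat.eq_dec x n) as [->|Hn].
      - now rewrite !upd_eq.
      - rewrite !upd_neq by auto. auto. }
    split; intros Hd d; now apply E.
Qed.

Fixpoint vars (phi : form) : list nat :=
  match phi with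
  | fEq i j => [i; j]
  | fRel _ xs => xs
  | fNot a => vars a
  | fAnd a b | fOr a b => vars a ++ vars b
  | fEx x a | fAll x a => x :: vars a
  end.

Lemma free_vars (phi : form) (x : nat) : free x phi -> In x (vars phi).
Proof.
  induction phi; simpl; intros H; try tauto; try (apply in_or_app; tauto).
  destruct H as [->| ->]; auto.
Qed.

Definition vbound (phi : form) : nat := S (list_max (vars phi)).

Lemma le_list_max (l : list nat) (x : nat) : In x l -> x <= list_max l.
Proof.
  intros H. pose proof (proj1 (list_max_le l (list_max l)) (le_n _)) as F.
  rewrite Forall_forall in F. auto.
Qed.

Lemma free_vbound (phi : form) (x : nat) : free x phi -> x < vbound phi.
Proof. intros H. apply free_vars, le_list_max in H. unfold vbound. lia. Qed.

Definition fresh (rho : nat -> nat) (phi : form) : nat :=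
  S (list_max (map rho (vars phi))).

Lemma free_fresh (rho : nat -> nat) (phi : form) (x : nat) :
  free x phi -> rho x < fresh rho phi.
Proof.
  intros H. apply free_vars, (in_map rho), le_list_max in H. unfold fresh. lia.
Qed.

(** Bound variables move above the images of all variables of the body, so nothing is captured even
    if [rho] is not injective. *)
Fixpoint ren (rho : nat -> nat) (phi : form) : form :=
  match phi with
  | fEq i j => fEq (rho i) (rho j)
  | fRel r xs => fRel r (map rho xs)
  | fNot a => fNot (ren rho a)
  | fAnd a b => fAnd (ren rho a) (ren rho b)
  | fOr a b => fOr (ren rho a) (ren rho b)
  | fEx x a => fEx (fresh rho a) (ren (upd rho x (fresh rho a)) a)
  | fAll x a => fAll (fresh rho a) (ren (upd rho x (fresh rho a)) a)
  end.

Lemma sat_ren (M : structure) (phi : form) : forall rho v,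
  sat M v (ren rho phi) <-> sat M (fun x => v (rho x)) phi.
Proof.
  assert (E : forall phi rho (v : nat -> dom M) n d,
    (forall rho v, sat M v (ren rho phi) <-> sat M (fun x => v (rho x)) phi) ->
    sat M (upd v (fresh rho phi) d) (ren (upd rho n (fresh rho phi)) phi) <->
    sat M (upd (fun x => v (rho x)) n d) phi).
  { intros a rho v n d IH. rewrite IH. apply sat_ext. intros x Hx.
    destruct (Nat.eq_dec x n) as [->|Hn].
    - now rewrite !upd_eq.
    - rewrite !(upd_neq _ n) by auto. apply upd_neq.
      apply (free_fresh rho) in Hx. lia. }
  induction phi; simpl; intros rho v.
  - tauto.
  - rewrite map_map. tauto.
  - rewrite IHphi. tauto.
  - rewrite IHphi1, IHphi2. tauto.
  - rewrite IHphi1, IHphi2. tauto.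
  - split; intros [d Hd]; exists d; eapply E; eauto.
  - split; intros Hd d; eapply E; eauto.
Qed.

Lemma free_ren (phi : form) : forall rho x,
  free x (ren rho phi) <-> exists y, free y phi /\ x = rho y.
Proof.
  assert (E : forall phi rho n x,
    (forall rho x, free x (ren rho phi) <-> exists y, free y phi /\ x = rho y) ->
    (x <> fresh rho phi /\ free x (ren (upd rho n (fresh rho phi)) phi)) <->
    exists y, (y <> n /\ free y phi) /\ x = rho y).
  { intros a rho n x IH. rewrite IH. split.
    - intros [H1 [y [H2 H3]]]. destruct (Nat.eq_dec y n) as [->|Hn].
      + rewrite upd_eq in H3. tauto.
      + rewrite upd_neq in H3 by auto. exists y. auto.
    - intros [y [[H1 H2] ->]]. split.
      + apply (free_fresh rho) in H2. lia.
      + exists y. rewrite upd_neq by auto. auto. }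
  induction phi; simpl; intros rho x.
  - split.
    + intros [->| ->]; eauto.
    + intros [y [[->| ->] ->]]; auto.
  - rewrite in_map_iff. split; intros [y [H1 H2]]; eauto.
  - apply IHphi.
  - rewrite IHphi1, IHphi2. split.
    + intros [[y [H1 H2]]|[y [H1 H2]]]; eauto.
    + intros [y [[H1|H1] H2]]; eauto.
  - rewrite IHphi1, IHphi2. split.
    + intros [[y [H1 H2]]|[y [H1 H2]]]; eauto.
    + intros [y [[H1|H1] H2]]; eauto.
  - now apply E.
  - now apply E.
Qed.

Lemma wf_ren (voc : vocabulary) (phi : form) : forall rho,
  wf voc (ren rho phi) <-> wf voc phi.
Proof.
  induction phi; simpl; intros rho; try tauto.
  - rewrite length_map. tauto.
  - apply IHphi.
  - rewrite IHphi1, IHphi2. tauto.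
  - rewrite IHphi1, IHphi2. tauto.
  - apply IHphi.
  - apply IHphi.
Qed.

Lemma qf_ren (phi : form) : forall rho, qf phi -> qf (ren rho phi).
Proof. induction phi; simpl; intros; intuition. Qed.

Fixpoint fsize (phi : form) : nat :=
  match phi with
  | fEq _ _ | fRel _ _ => 0
  | fNot a => S (fsize a)
  | fAnd a b | fOr a b => S (fsize a + fsize b)
  | fEx _ a | fAll _ a => S (fsize a)
  end.

Lemma fsize_ren (phi : form) : forall rho, fsize (ren rho phi) = fsize phi.
Proof. induction phi; simpl; intros; congruence. Qed.

Scheme ExF_mind := Induction for ExF Sort Prop
with AllF_mind := Induction for AllF Sort Prop.
Combined Scheme prenex_ind from ExF_mind, AllF_mind.

Lemma prenex_ren :
  (forall n phi, ExF n phi -> forall rho, ExF n (ren rho phi)) /\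
  (forall n phi, AllF n phi -> forall rho, AllF n (ren rho phi)).
Proof.
  apply (prenex_ind (fun n phi _ => forall rho, ExF n (ren rho phi))
                    (fun n phi _ => forall rho, AllF n (ren rho phi)));
    simpl; intros; eauto using qf_ren, ExF, AllF.
Qed.

Lemma prenex_S :
  (forall n phi, ExF n phi -> ExF (S n) phi) /\
  (forall n phi, AllF n phi -> AllF (S n) phi).
Proof.
  apply (prenex_ind (fun n phi _ => ExF (S n) phi) (fun n phi _ => AllF (S n) phi));
    intros; auto using ExF, AllF.
Qed.

Lemma ExF_mono (m n : nat) (phi : form) : m <= n -> ExF m phi -> ExF n phi.
Proof. induction 1; auto. intros. apply prenex_S. auto. Qed.

(** The conditions on symbols and free variables go one way only: enough for a prenex form of a
    sentence to be a sentence again. *)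
Definition replaces (c d : form) : Prop :=
  (forall voc, wf voc d -> wf voc c) /\
  (forall x, free x c -> free x d) /\
  (forall M v, sat M v c <-> sat M v d).

Lemma replaces_refl (c : form) : replaces c c.
Proof. split; [|split]; tauto. Qed.

Lemma replaces_trans (c d e : form) : replaces c d -> replaces d e -> replaces c e.
Proof.
  intros [W1 [F1 S1]] [W2 [F2 S2]]. repeat split; auto.
  - intros. now apply S2, S1.
  - intros. now apply S1, S2.
Qed.

Lemma replaces_not (a b : form) : replaces a b -> replaces (fNot a) (fNot b).
Proof.
  intros [W [F Sa]]. repeat split; simpl; auto; intros H1 H2; apply H1, Sa, H2.
Qed.

Lemma replaces_and (a b c d : form) :
  replaces a c -> replaces b d -> replaces (fAnd a b) (fAnd c d).
Proof.
  intros [W1 [F1 S1]] [W2 [F2 S2]]. split; [|split]; simpl.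
  - firstorder.
  - firstorder.
  - intros. rewrite S1, S2. tauto.
Qed.

Lemma replaces_ex (x : nat) (a b : form) : replaces a b -> replaces (fEx x a) (fEx x b).
Proof.
  intros [W [F Sa]]. split; [|split]; simpl; auto.
  - firstorder.
  - intros. split; intros [d H]; exists d; now apply Sa.
Qed.

Lemma replaces_all (x : nat) (a b : form) :
  replaces a b -> replaces (fAll x a) (fAll x b).
Proof.
  intros [W [F Sa]]. split; [|split]; simpl; auto.
  - firstorder.
  - intros. split; intros H d; now apply Sa.
Qed.

Lemma prenex_not :
  (forall n a, ExF n a -> exists c, AllF n c /\ replaces c (fNot a)) /\
  (forall n a, AllF n a -> exists c, ExF n c /\ replaces c (fNot a)).
Proof.
  apply (prenex_ind (fun n a _ => exists c, AllF n c /\ replaces c (fNot a))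
                    (fun n a _ => exists c, ExF n c /\ replaces c (fNot a))).
  - intros a H. exists (fNot a). split; [auto using ExF, AllF | apply replaces_refl].
  - intros n a _ [c [H1 H2]]. exists c. split; auto. auto using ExF, AllF.
  - intros n x a _ [c [H1 H2]]. exists (fAll x c). split; [auto using ExF, AllF|].
    apply (replaces_trans _ (fAll x (fNot a))); [now apply replaces_all|].
    split; [|split]; simpl; auto. firstorder.
  - intros a H. exists (fNot a). split; [auto using ExF, AllF | apply replaces_refl].
  - intros n a _ [c [H1 H2]]. exists c. split; auto. auto using ExF, AllF.
  - intros n x a _ [c [H1 H2]]. exists (fEx x c). split; [auto using ExF, AllF|].
    apply (replaces_trans _ (fEx x (fNot a))); [now apply replaces_ex|].
    split; [|split]; simpl; auto. intros M v. split; [firstorder|].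
    apply not_all_ex_not.
Qed.

Lemma replaces_and_comm (a b : form) : replaces (fAnd a b) (fAnd b a).
Proof. split; [|split]; simpl; intros; tauto. Qed.

Definition freshen (x : nat) (a b : form) : form :=
  ren (upd (fun y => y) x (vbound (fAnd a b))) a.

Lemma sat_freshen (M : structure) (v : nat -> dom M) (x : nat) (a b : form) (d : dom M) :
  sat M (upd v (vbound (fAnd a b)) d) (freshen x a b) <-> sat M (upd v x d) a.
Proof.
  unfold freshen. rewrite sat_ren. apply sat_ext. intros y Hy.
  destruct (Nat.eq_dec y x) as [->|Hn].
  - now rewrite !upd_eq.
  - rewrite !(upd_neq _ x) by auto. apply upd_neq.
    assert (y < vbound (fAnd a b)) by (apply free_vbound; simpl; auto). lia.
Qed.

Lemma sat_upd_vbound (M : structure) (v : nat -> dom M) (a b : form) (d : dom M) :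
  sat M (upd v (vbound (fAnd a b)) d) b <-> sat M v b.
Proof.
  apply sat_ext. intros y Hy. apply upd_neq.
  assert (y < vbound (fAnd a b)) by (apply free_vbound; simpl; auto). lia.
Qed.

Lemma free_freshen (x y : nat) (a b : form) :
  y <> vbound (fAnd a b) -> free y (freshen x a b) -> y <> x /\ free y a.
Proof.
  unfold freshen. rewrite free_ren. intros H [z [H1 H2]].
  destruct (Nat.eq_dec z x) as [->|Hn].
  - rewrite upd_eq in H2. tauto.
  - rewrite upd_neq in H2 by auto. now subst.
Qed.

Lemma pull_ex (x : nat) (a b : form) :
  replaces (fEx (vbound (fAnd a b)) (fAnd (freshen x a b) b)) (fAnd (fEx x a) b).
Proof.
  split; [|split].
  - simpl. intros voc. unfold freshen. rewrite wf_ren. tauto.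
  - simpl. intros y [H1 [H2|H2]]; auto. left. eapply free_freshen; eauto.
  - intros M v. simpl. setoid_rewrite sat_freshen. setoid_rewrite sat_upd_vbound.
    firstorder.
Qed.

Lemma pull_all (x : nat) (a b : form) :
  replaces (fAll (vbound (fAnd a b)) (fAnd (freshen x a b) b)) (fAnd (fAll x a) b).
Proof.
  split; [|split].
  - simpl. intros voc. unfold freshen. rewrite wf_ren. tauto.
  - simpl. intros y [H1 [H2|H2]]; auto. left. eapply free_freshen; eauto.
  - intros M v. simpl. setoid_rewrite sat_freshen. setoid_rewrite sat_upd_vbound.
    (* The assignment itself supplies an element at which to instantiate the quantifier and extract
       [b]. *)
    split; [|firstorder]. intros H. split; [firstorder|]. apply (H (v 0)).
Qed.

(** Leading quantifiers are pulled out one at a time, and once both formulas lie in the dual class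
    one level down, the dual half of the induction hypothesis applies. The inner recursion is on
    total size, since renaming keeps the size but destroys the subterm relation. *)
Lemma prenex_and (k : nat) :
  (forall a b, ExF k a -> ExF k b -> exists c, ExF k c /\ replaces c (fAnd a b)) /\
  (forall a b, AllF k a -> AllF k b -> exists c, AllF k c /\ replaces c (fAnd a b)).
Proof.
  induction k as [|k [IHe IHa]].
  - split; intros a b Ha Hb; inversion Ha; inversion Hb; subst;
      exists (fAnd a b); (split; [constructor; simpl; auto | apply replaces_refl]).
  - split.
    + assert (E : forall m a b, fsize a + fsize b < m -> ExF (S k) a -> ExF (S k) b ->
        exists c, ExF (S k) c /\ replaces c (fAnd a b)).
      { induction m as [|m IH]; [lia|]. intros a b Hm Ha Hb.
        inversion Ha as [|? ? Ha'|? x a' Ha']; subst.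
        - inversion Hb as [|? ? Hb'|? y b' Hb']; subst.
          + destruct (IHa a b Ha' Hb') as [c [H1 H2]]. exists c.
            split; auto. auto using ExF, AllF.
          + destruct (IH (freshen y b' a) a) as [c [H1 H2]]; auto.
            * unfold freshen. rewrite fsize_ren. simpl in Hm. lia.
            * now apply prenex_ren.
            * exists (fEx (vbound (fAnd b' a)) c). split; [auto using ExF, AllF|].
              eapply replaces_trans; [now apply replaces_ex, H2|].
              eapply replaces_trans; [apply pull_ex|]. apply replaces_and_comm.
        - destruct (IH (freshen x a' b) b) as [c [H1 H2]]; auto.
          + unfold freshen. rewrite fsize_ren. simpl in Hm. lia.
          + now apply prenex_ren.
          + exists (fEx (vbound (fAnd a' b)) c). split; [auto using ExF, AllF|].
            eapply replaces_trans; [now apply replaces_ex, H2|]. apply pull_ex. }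
      intros a b. apply (E (S (fsize a + fsize b))). apply Nat.lt_succ_diag_r.
    + assert (E : forall m a b, fsize a + fsize b < m -> AllF (S k) a -> AllF (S k) b ->
        exists c, AllF (S k) c /\ replaces c (fAnd a b)).
      { induction m as [|m IH]; [lia|]. intros a b Hm Ha Hb.
        inversion Ha as [|? ? Ha'|? x a' Ha']; subst.
        - inversion Hb as [|? ? Hb'|? y b' Hb']; subst.
          + destruct (IHe a b Ha' Hb') as [c [H1 H2]]. exists c.
            split; auto. auto using ExF, AllF.
          + destruct (IH (freshen y b' a) a) as [c [H1 H2]]; auto.
            * unfold freshen. rewrite fsize_ren. simpl in Hm. lia.
            * now apply prenex_ren.
            * exists (fAll (vbound (fAnd b' a)) c). split; [auto using ExF, AllF|].
              eapply replaces_trans; [now apply replaces_all, H2|].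
              eapply replaces_trans; [apply pull_all|]. apply replaces_and_comm.
        - destruct (IH (freshen x a' b) b) as [c [H1 H2]]; auto.
          + unfold freshen. rewrite fsize_ren. simpl in Hm. lia.
          + now apply prenex_ren.
          + exists (fAll (vbound (fAnd a' b)) c). split; [auto using ExF, AllF|].
            eapply replaces_trans; [now apply replaces_all, H2|]. apply pull_all. }
      intros a b. apply (E (S (fsize a + fsize b))). apply Nat.lt_succ_diag_r.
Qed.

(** As syntax, the prenex classes are not closed under conjunction or negation. Closed under
    [replaces], they respect conjunction, and negation costs one level. *)
Definition low (k : nat) (phi : form) : Prop :=
  exists psi, ExF k psi /\ replaces psi phi.

Lemma low_mono (m n : nat) (phi : form) : m <= n -> low m phi -> low n phi.
Proof. intros H [psi [H1 H2]]. exists psi. split; auto. eapply ExF_mono; eauto. Qed.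

Lemma low_replaces (k : nat) (a b : form) : replaces a b -> low k a -> low k b.
Proof. intros H [c [H1 H2]]. exists c. split; auto. eapply replaces_trans; eauto. Qed.

Lemma low_not (k : nat) (a : form) : low k a -> low (S k) (fNot a).
Proof.
  intros [c [H1 H2]]. destruct (proj1 prenex_not k c H1) as [d [H3 H4]].
  exists d. split; [auto using ExF, AllF|]. eapply replaces_trans; eauto.
  now apply replaces_not.
Qed.

Lemma low_and (k : nat) (a b : form) : low k a -> low k b -> low k (fAnd a b).
Proof.
  intros [c [H1 H2]] [d [H3 H4]].
  destruct (proj1 (prenex_and k) c d H1 H3) as [e [H5 H6]].
  exists e. split; auto. eapply replaces_trans; eauto. now apply replaces_and.
Qed.

Lemma low_ex (k x : nat) (a : form) : low (S k) a -> low (S k) (fEx x a).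
Proof.
  intros [c [H1 H2]]. exists (fEx x c). split; [auto using ExF, AllF | now apply replaces_ex].
Qed.

Lemma low_ren (k : nat) (rho : nat -> nat) (a : form) : low k a -> low k (ren rho a).
Proof.
  intros [c [H1 [H2 [H3 H4]]]]. exists (ren rho c).
  split; [now apply prenex_ren|]. split; [|split].
  - intros voc. rewrite !wf_ren. auto.
  - intros x. rewrite !free_ren. firstorder.
  - intros M v. now rewrite !sat_ren.
Qed.

Lemma low_qf (k : nat) (a : form) : qf a -> low k a.
Proof.
  intros H. apply (low_mono 0); [lia|]. exists a. split; [auto using ExF, AllF|].
  apply replaces_refl.
Qed.

Lemma low_exists (phi : form) : exists k, low k phi.
Proof.
  assert (N : forall a, (exists k, low k a) -> exists k, low k (fNot a)).
  { intros a [k H]. exists (S k). now apply low_not. }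
  assert (A : forall a b, (exists k, low k a) -> (exists k, low k b) ->
    exists k, low k (fAnd a b)).
  { intros a b [k H] [l H']. exists (max k l).
    apply low_and; [apply (low_mono k) | apply (low_mono l)]; auto; lia. }
  assert (X : forall x a, (exists k, low k a) -> exists k, low k (fEx x a)).
  { intros x a [k H]. exists (S k). apply low_ex. now apply (low_mono k); auto. }
  induction phi; auto.
  - exists 0. now apply low_qf.
  - exists 0. now apply low_qf.
  - destruct (N _ (A _ _ (N _ IHphi1) (N _ IHphi2))) as [k H]. exists k.
    eapply low_replaces; [|apply H]. split; [|split]; simpl; auto.
    intros. tauto.
  - destruct (N _ (X n _ (N _ IHphi))) as [k H]. exists k.
    eapply low_replaces; [|apply H]. split; [|split]; simpl; auto.
    intros M v. split.
    + intros H1 d. apply NNPP. intros H2. apply H1. eauto.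
    + intros H1 [d H2]. auto.
Qed.

(** * Types *)

Arguments Cantor.to_nat : simpl never.

Lemma code_list_inj (l : list nat) : forall l', code_list l = code_list l' -> l = l'.
Proof.
  induction l as [|a l IH]; intros [|a' l'] H; simpl in H; try discriminate; auto.
  apply eq_add_S, Cantor.to_nat_inj in H. injection H as -> H.
  now rewrite (IH l' H).
Qed.

Lemma code_inj (r r' : nat) (l l' : list nat) :
  code r l = code r' l' -> r = r' /\ l = l'.
Proof.
  unfold code. intros H. apply Cantor.to_nat_inj in H. injection H as -> H.
  auto using code_list_inj.
Qed.

(** An atom coded by [c] mentions only variables up to [c], so the type of stage [S c] can decide it
    for good. *)
Lemma le_code (r a : nat) (l : list nat) : In a l -> a <= code r l.
Proof.
  intros H. assert (E : a <= code_list l).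
  { induction l as [|b l IH]; destruct H; subst; simpl code_list.
    - pose proof (Cantor.to_nat_non_decreasing a (code_list l)). lia.
    - pose proof (Cantor.to_nat_non_decreasing b (code_list l)). specialize (IH H). lia. }
  pose proof (Cantor.to_nat_non_decreasing r (code_list l)). unfold code. lia.
Qed.

Fixpoint form_code (phi : form) : nat :=
  match phi with
  | fEq i j => Cantor.to_nat (0, Cantor.to_nat (i, j))
  | fRel r xs => Cantor.to_nat (1, code r xs)
  | fNot a => Cantor.to_nat (2, form_code a)
  | fAnd a b => Cantor.to_nat (3, Cantor.to_nat (form_code a, form_code b))
  | fOr a b => Cantor.to_nat (4, Cantor.to_nat (form_code a, form_code b))
  | fEx x a => Cantor.to_nat (5, Cantor.to_nat (x, form_code a))
  | fAll x a => Cantor.to_nat (6, Cantor.to_nat (x, form_code a))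
  end.

Lemma form_code_inj (a : form) : forall b, form_code a = form_code b -> a = b.
Proof.
  induction a; intros [] H; simpl in H; apply Cantor.to_nat_inj in H;
    try discriminate; injection H as H;
    try (apply code_inj in H; destruct H; congruence);
    try (apply Cantor.to_nat_inj in H; injection H as H H'); f_equal; auto.
Qed.

Lemma form_enumeration : exists e : nat -> form, forall phi, exists n, e n = phi.
Proof.
  exists (fun n => epsilon (inhabits (fEq 0 0)) (fun phi => form_code phi = n)).
  intros phi. exists (form_code phi). apply form_code_inj.
  apply (epsilon_spec (inhabits (fEq 0 0)) (fun psi => form_code psi = form_code phi)).
  eauto.
Qed.

(* Satisfiability is tested in infinite models only, so that a realization of
   finitely many variables can always be extended by a new element. *)
Definition infinite_model (U : form -> Prop) (M : structure) : Prop :=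
  model M U /\ infinite_type (dom M).

Definition satisfiable (U : form -> Prop) (l : list form) : Prop :=
  exists M v, infinite_model U M /\ forall phi, In phi l -> sat M v phi.

Definition finsat (U S : form -> Prop) : Prop :=
  forall l, (forall phi, In phi l -> S phi) -> satisfiable U l.

(** One type in all variables at once. It also decides formulas with symbols outside the vocabulary,
    on which the theories say nothing; hence the condition [wf] in [agree_at]. *)
Definition ctype (U r : form -> Prop) : Prop :=
  finsat U r /\ forall phi, r phi \/ r (fNot phi).

(** If both extensions failed, the members in [S] of the two failing lists would be realized
    together, and the truth value of [phi] there would realize one of these lists. *)
Lemma finsat_add (U S : form -> Prop) (phi : form) : finsat U S ->
  finsat U (fun a => S a \/ a = phi) \/ finsat U (fun a => S a \/ a = fNot phi).
Proof.
  intros HS. apply NNPP. intros H. apply not_or_and in H. destruct H as [H1 H2].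
  apply not_all_ex_not in H1. destruct H1 as [l1 H1].
  apply not_all_ex_not in H2. destruct H2 as [l2 H2].
  apply imply_to_and in H1. destruct H1 as [I1 H1].
  apply imply_to_and in H2. destruct H2 as [I2 H2].
  set (sel := fun a => if excluded_middle_informative (S a) then true else false).
  assert (sel_spec : forall a, sel a = true <-> S a).
  { intros a. unfold sel. destruct excluded_middle_informative; split; auto; discriminate. }
  destruct (HS (filter sel (l1 ++ l2))) as [M [v [Hm Hs]]].
  { intros a Ha. apply filter_In in Ha. now apply sel_spec. }
  destruct (classic (sat M v phi)) as [Hp|Hp].
  - apply H1. exists M, v. split; auto. intros a Ha.
    destruct (I1 a Ha) as [Hsa | ->]; auto. apply Hs, filter_In. split.
    + apply in_or_app. auto.
    + now apply sel_spec.
  - apply H2. exists M, v. split; auto. intros a Ha.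
    destruct (I2 a Ha) as [Hsa | ->]; auto. apply Hs, filter_In. split.
    + apply in_or_app. auto.
    + now apply sel_spec.
Qed.

Lemma lindenbaum (U S : form -> Prop) :
  finsat U S -> exists r, ctype U r /\ forall phi, S phi -> r phi.
Proof.
  intros HS. destruct form_enumeration as [e He].
  set (add := fun (s : form -> Prop) phi a => s a \/
    (finsat U (fun b => s b \/ b = phi) /\ a = phi) \/
    (~ finsat U (fun b => s b \/ b = phi) /\ a = fNot phi)).
  set (st := fix st n := match n with 0 => S | Datatypes.S m => add (st m) (e m) end).
  assert (Hst : forall n, finsat U (st n)).
  { induction n as [|n IH]; auto. simpl.
    destruct (classic (finsat U (fun b => st n b \/ b = e n))) as [H|H].
    - intros l Hl. apply H. intros a Ha. destruct (Hl a Ha) as [?|[?|?]]; tauto.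
    - destruct (finsat_add U (st n) (e n) IH) as [H'|H']; [tauto|].
      intros l Hl. apply H'. intros a Ha. destruct (Hl a Ha) as [?|[?|?]]; tauto. }
  assert (mono : forall m n a, m <= n -> st m a -> st n a).
  { intros m n a. induction 1; auto. intros. simpl. unfold add. auto. }
  exists (fun a => exists n, st n a). split; [split|].
  - intros l Hl. assert (exists n, forall a, In a l -> st n a) as [n Hn].
    { clear -Hl mono. induction l as [|a l IH].
      - exists 0. intros a [].
      - destruct IH as [n Hn]. { intros b Hb. apply Hl. now right. }
        destruct (Hl a (or_introl eq_refl)) as [m Hm].
        exists (max m n). intros b [<-|Hb].
        + apply (mono m); auto. lia.
        + apply (mono n); auto. lia. }
    now apply (Hst n).
  - intros phi. destruct (He phi) as [n <-].
    destruct (classic (finsat U (fun b => st n b \/ b = e n))) as [H|H].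
    + left. exists (Datatypes.S n). simpl. unfold add. auto.
    + right. exists (Datatypes.S n). simpl. unfold add. auto.
  - intros phi H. exists 0. exact H.
Qed.

Lemma ctype_conseq (U r : form -> Prop) (l : list form) (phi : form) : ctype U r ->
  (forall a, In a l -> r a) ->
  (forall M v, infinite_model U M -> (forall a, In a l -> sat M v a) -> sat M v phi) ->
  r phi.
Proof.
  intros [F C] Hl H. destruct (C phi) as [|N]; auto. exfalso.
  destruct (F (fNot phi :: l)) as [M [v [Hm Hs]]].
  { intros a [<-|Ha]; auto. }
  apply (Hs (fNot phi)); [now left|]. apply H; auto. intros a Ha. apply Hs. now right.
Qed.

Lemma ctype_not (U r : form -> Prop) (phi : form) : ctype U r ->
  r (fNot phi) <-> ~ r phi.
Proof.
  intros H. split.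
  - intros H1 H2. destruct (proj1 H [phi; fNot phi]) as [M [v [_ Hs]]].
    { intros a [<-|[<-|[]]]; auto. }
    apply (Hs (fNot phi) (or_intror (or_introl eq_refl))), Hs. now left.
  - intros H1. destruct (proj2 H phi); tauto.
Qed.

Lemma ctype_equiv (U r : form -> Prop) (a b : form) : ctype U r ->
  (forall M v, sat M v a <-> sat M v b) -> r a <-> r b.
Proof.
  intros H E. split; intros Hr.
  - apply (ctype_conseq U r [a]); auto.
    + intros c [<-|[]]; auto.
    + intros M v _ Hs. apply E, Hs. now left.
  - apply (ctype_conseq U r [b]); auto.
    + intros c [<-|[]]; auto.
    + intros M v _ Hs. apply E, Hs. now left.
Qed.

Lemma ctype_sentence (voc : vocabulary) (U r : form -> Prop) (phi : form) :
  complete_theory voc U -> ctype U r -> sentence voc phi -> r phi <-> U phi.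
Proof.
  intros HU Hr Hs.
  assert (E : forall a, U a -> r a).
  { intros a Ha. apply (ctype_conseq U r []); auto.
    - intros b [].
    - intros M v [[_ HM] _] _. now apply HM. }
  split; auto. intros Hp. destruct (proj1 (proj2 (proj2 HU)) phi Hs) as [|N]; auto.
  exfalso. apply E in N. apply (ctype_not U r phi Hr) in N. auto.
Qed.

Lemma ctype_exists (U : form -> Prop) : has_infinite_model U -> exists r, ctype U r.
Proof.
  intros [M HM]. destruct (lindenbaum U (fun _ => False)) as [r [H _]]; eauto.
  intros l Hl. destruct HM as [Hm Hi].
  destruct (proj1 Hm) as [d]. exists M, (fun _ => d).
  split; [now split|]. intros a Ha. destruct (Hl a Ha).
Qed.

Definition below (n : nat) (phi : form) : Prop := forall x, free x phi -> x < n.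

(** Decisions below [n] are kept and all others may be revised, so the realization asked for is free
    to reinterpret the variables from [n] on. *)
Lemma ctype_extend (U r D : form -> Prop) (n : nat) : ctype U r ->
  (forall l d, (forall a, In a l -> r a) -> (forall a, In a d -> D a) ->
     exists M v, infinite_model U M /\
       (forall a, In a l -> below n a -> sat M v a) /\
       (forall a, In a d -> sat M v a)) ->
  exists r', ctype U r' /\ (forall a, below n a -> r' a <-> r a) /\
    (forall a, D a -> r' a).
Proof.
  intros Hr H.
  destruct (lindenbaum U (fun a => (r a /\ below n a) \/ D a)) as [r' [Hr' I]].
  { intros l Hl.
    assert (exists l1 l2, (forall a, In a l1 -> r a) /\ (forall a, In a l2 -> D a) /\
      forall a, In a l -> (In a l1 /\ below n a) \/ In a l2) as [l1 [l2 [H1 [H2 H3]]]].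
    { clear -Hl. induction l as [|a l IH].
      - exists [], []. simpl. tauto.
      - destruct IH as [l1 [l2 [H1 [H2 H3]]]]. { intros b Hb. apply Hl. now right. }
        destruct (Hl a (or_introl eq_refl)) as [[Ha Hb]|Ha].
        + exists (a :: l1), l2. split; [|split]; auto.
          * intros b [<-|?]; auto.
          * intros b [<-|Hb']; simpl; auto. destruct (H3 b Hb'); tauto.
        + exists l1, (a :: l2). split; [|split]; auto.
          * intros b [<-|?]; auto.
          * intros b [<-|Hb']; simpl; auto. destruct (H3 b Hb'); tauto. }
    destruct (H l1 l2 H1 H2) as [M [v [Hm [Hs1 Hs2]]]]. exists M, v. split; auto.
    intros a Ha. destruct (H3 a Ha) as [[? ?]|?]; auto. }
  exists r'. split; auto. split; auto.
  intros a Ha. split; auto. intros Hr'a. apply NNPP. intros N.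
  apply (ctype_not U r a Hr) in N.
  assert (r' (fNot a)) by (apply I; left; auto).
  apply (ctype_not U r' a Hr') in H0. auto.
Qed.

(** The quantifier makes this a sentence, hence [below] every bound including 0; it is also why
    [low_conj] starts at level one. *)
Definition ftrue : form := fEx 0 (fEq 0 0).

Definition conj (l : list form) : form := fold_right fAnd ftrue l.

Lemma sat_ftrue (M : structure) (v : nat -> dom M) : sat M v ftrue.
Proof. exists (v 0). reflexivity. Qed.

Lemma sat_conj (M : structure) (v : nat -> dom M) (l : list form) :
  sat M v (conj l) <-> forall a, In a l -> sat M v a.
Proof.
  induction l as [|b l IH]; simpl.
  - split; [tauto|]. intros _. apply sat_ftrue.
  - change (fold_right fAnd ftrue l) with (conj l). rewrite IH. split.
    + intros [H1 H2] a [<-|Ha]; auto.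
    + auto.
Qed.

Lemma wf_conj (voc : vocabulary) (l : list form) :
  (forall a, In a l -> wf voc a) -> wf voc (conj l).
Proof. induction l; simpl; auto. Qed.

Lemma free_conj (l : list form) (x : nat) :
  free x (conj l) -> exists a, In a l /\ free x a.
Proof.
  induction l as [|b l IH]; simpl.
  - lia.
  - intros [H|H]; eauto. destruct (IH H) as [a [H1 H2]]. eauto.
Qed.

Lemma low_conj (k : nat) (l : list form) :
  (forall a, In a l -> low (S k) a) -> low (S k) (conj l).
Proof.
  induction l as [|b l IH]; simpl; intros H.
  - apply low_ex, low_qf. exact I.
  - apply low_and; auto.
Qed.

Definition exs (xs : list nat) (phi : form) : form := fold_right fEx phi xs.

Lemma sat_exs_intro (M : structure) (phi : form) (xs : list nat) : forall v,
  sat M v phi -> sat M v (exs xs phi).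
Proof.
  induction xs as [|x xs IH]; simpl; auto. intros v H. exists (v x).
  change (fold_right fEx phi xs) with (exs xs phi).
  apply IH. revert H. apply sat_ext. intros y _. unfold upd.
  destruct (Nat.eqb_spec y x); congruence.
Qed.

Lemma sat_exs_elim (M : structure) (phi : form) (xs : list nat) : forall v,
  sat M v (exs xs phi) ->
  exists w, (forall x, ~ In x xs -> w x = v x) /\ sat M w phi.
Proof.
  induction xs as [|x xs IH]; simpl; intros v H.
  - eauto.
  - destruct H as [d H]. destruct (IH _ H) as [w [H1 H2]]. exists w. split; auto.
    intros y Hy. rewrite H1 by tauto. apply upd_neq. firstorder.
Qed.

Lemma free_exs (phi : form) (x : nat) (xs : list nat) :
  free x (exs xs phi) -> free x phi /\ ~ In x xs.
Proof. induction xs; simpl; intuition. Qed.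

Lemma wf_exs (voc : vocabulary) (phi : form) (xs : list nat) :
  wf voc phi -> wf voc (exs xs phi).
Proof. induction xs; simpl; auto. Qed.

Lemma low_exs (k : nat) (phi : form) (xs : list nat) :
  low (S k) phi -> low (S k) (exs xs phi).
Proof. induction xs; simpl; auto using low_ex. Qed.

Definition agree_at (voc : vocabulary) (k n : nat) (q r : form -> Prop) : Prop :=
  forall phi, wf voc phi -> low k phi -> below n phi -> (q phi <-> r phi).

Lemma agree_at_sym (voc : vocabulary) (k n : nat) (q r : form -> Prop) :
  agree_at voc k n q r -> agree_at voc k n r q.
Proof. intros H phi H1 H2 H3. symmetry. auto. Qed.

Lemma agree_at_trans (voc : vocabulary) (k n : nat) (q r t : form -> Prop) :
  agree_at voc k n q r -> agree_at voc k n r t -> agree_at voc k n q t.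
Proof. intros H H' phi H1 H2 H3. rewrite (H phi), (H' phi); tauto. Qed.

Lemma agree_at_le (voc : vocabulary) (k k' n n' : nat) (q r : form -> Prop) :
  k <= k' -> n <= n' -> agree_at voc k' n' q r -> agree_at voc k n q r.
Proof.
  intros Hk Hn H phi H1 H2 H3. apply H; auto.
  - now apply (low_mono k).
  - intros x Hx. apply H3 in Hx. lia.
Qed.

(* Existentially quantifying away the variables from [a] on costs one level,
   so agreement at level [k+1] below [a] leaves room for agreement at level [k]
   in all variables below [b]. *)
Lemma ctype_amalgam (voc : vocabulary) (U U' r q : form -> Prop) (k a b : nat) :
  ctype U r -> ctype U' q -> agree_at voc (S k) a r q ->
  exists r', ctype U r' /\ (forall phi, below a phi -> r' phi <-> r phi) /\
    agree_at voc k b r' q.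
Proof.
  intros Hr Hq Hag.
  destruct (ctype_extend U r (fun phi => wf voc phi /\ low (S k) phi /\ below b phi /\ q phi) a)
    as [r' [H1 [H2 H3]]]; auto.
  - intros l d Hl Hd.
    set (th := exs (seq a (b - a)) (conj d)).
    assert (Hth : r th).
    { apply Hag.
      - apply wf_exs, wf_conj. intros c Hc. now apply Hd.
      - apply low_exs, low_conj. intros c Hc. now apply Hd.
      - intros x Hx. apply free_exs in Hx. destruct Hx as [Hx Hn].
        apply free_conj in Hx. destruct Hx as [c [Hc Hx]].
        apply (proj2 (proj2 (Hd c Hc))) in Hx. rewrite in_seq in Hn. lia.
      - apply (ctype_conseq U' q d); auto.
        + intros c Hc. now apply Hd.
        + intros M v _ Hs. now apply sat_exs_intro, sat_conj. }
    destruct (proj1 Hr (th :: l)) as [M [v [Hm Hs]]].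
    { intros c [<-|Hc]; auto. }
    destruct (sat_exs_elim M (conj d) _ v (Hs th (or_introl eq_refl))) as [w [Hw1 Hw2]].
    exists M, w. split; auto. split.
    + intros c Hc Hb. apply (sat_ext M c w v).
      * intros x Hx. apply Hw1. apply Hb in Hx. rewrite in_seq. lia.
      * apply Hs. now right.
    + now apply sat_conj.
  - exists r'. split; auto. split; auto.
    assert (E : forall phi, wf voc phi -> low k phi -> below b phi -> q phi -> r' phi).
    { intros phi W L B Hphi. apply H3. repeat split; auto. apply (low_mono k); auto. }
    intros phi W L B. split; auto. intros Hphi. apply NNPP. intros N.
    apply (ctype_not U' q phi Hq) in N.
    (* The imposed formulas were taken at level [S k] so as to include the negations of those of
       level [k]. *)
    assert (r' (fNot phi)) as Hn.
    { apply H3. repeat split; auto. now apply low_not. }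
    apply (ctype_not U r' phi H1) in Hn. auto.
Qed.

(** The variables become the elements of a structure on omega with true equality; no quotient is
    taken at the end. *)
Definition distinct (n : nat) (r : form -> Prop) : Prop :=
  forall i j, i < j -> j < n -> r (fNot (fEq i j)).

Definition inst (x y : nat) (phi : form) : form := ren (upd (fun z => z) x y) phi.

Definition witnessed (n : nat) (r : form -> Prop) (phi : form) : Prop :=
  forall x psi, phi = fEx x psi -> exists y, y < n /\ r (inst x y psi).

Lemma sat_inst (M : structure) (v : nat -> dom M) (x y : nat) (phi : form) :
  sat M v (inst x y phi) <-> sat M (upd v x (v y)) phi.
Proof.
  unfold inst. rewrite sat_ren. apply sat_ext. intros z _. unfold upd.
  destruct (Nat.eqb z x); auto.
Qed.

Lemma below_inst (n x y : nat) (phi : form) :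
  below n (fEx x phi) -> y < n -> below n (inst x y phi).
Proof.
  intros H Hy z Hz. apply free_ren in Hz. destruct Hz as [w [Hw ->]].
  destruct (Nat.eq_dec w x) as [->|Hn].
  - now rewrite upd_eq.
  - rewrite upd_neq by auto. apply H. simpl. auto.
Qed.

Lemma below_le (m n : nat) (phi : form) : m <= n -> below m phi -> below n phi.
Proof. intros H B x Hx. apply B in Hx. lia. Qed.

Lemma ctype_add_element (U r : form -> Prop) (n : nat) (psi : form) :
  ctype U r -> distinct n r -> below (S n) psi ->
  (forall l, (forall a, In a l -> r a) -> exists M v d, infinite_model U M /\
     (forall a, In a l -> sat M v a) /\ (forall i, i < n -> v i <> d) /\
     sat M (upd v n d) psi) ->
  exists r', ctype U r' /\ (forall a, below n a -> r' a <-> r a) /\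
    distinct (S n) r' /\ r' psi.
Proof.
  intros Hr Hd Hb H.
  destruct (ctype_extend U r
    (fun phi => phi = psi \/ exists i, i < n /\ phi = fNot (fEq i n)) n)
    as [r' [H1 [H2 H3]]]; auto.
  - intros l d Hl Hdd. destruct (H l Hl) as [M [v [c [Hm [Hs [Hi Hp]]]]]].
    exists M, (upd v n c). split; auto. split.
    + intros a Ha Hba. apply (sat_ext M a _ v); auto.
      intros x Hx. apply upd_neq. apply Hba in Hx. lia.
    + intros a Ha. destruct (Hdd a Ha) as [->|[i [Hin ->]]]; auto.
      simpl. rewrite upd_eq, upd_neq by lia. auto.
  - exists r'. split; auto. split; auto. split; auto.
    intros i j Hij Hj. destruct (Nat.eq_dec j n) as [->|Hn].
    + apply H3. eauto.
    + apply H2; [|apply Hd; lia]. intros x. simpl. lia.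
Qed.

Lemma infinite_type_new (A : Type) (v : nat -> A) (n : nat) :
  infinite_type A -> exists d, forall i, i < n -> v i <> d.
Proof.
  intros H. apply NNPP. intros N. apply H. exists (map v (seq 0 n)).
  intros a. apply NNPP. intros Ha. apply N. exists a. intros i Hi E.
  apply Ha. rewrite <- E. apply in_map, in_seq. lia.
Qed.

Lemma below_inst_new (n x : nat) (phi : form) :
  below n (fEx x phi) -> below (S n) (inst x n phi).
Proof. intros H. apply below_inst; [|lia]. now apply (below_le n); auto. Qed.

(** If no committed variable is a witness, variable [n] becomes one, and it differs from all of them
    precisely because they are not witnesses. *)
Lemma ctype_witness (U r : form -> Prop) (n : nat) (phi : form) :
  ctype U r -> distinct n r -> below n phi -> r phi ->
  exists r', ctype U r' /\ (forall a, below n a -> r' a <-> r a) /\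
    distinct (S n) r' /\ witnessed (S n) r' phi.
Proof.
  intros Hr Hd Hb Hphi.
  destruct (classic (exists x psi, phi = fEx x psi /\
    forall y, y < n -> ~ r (inst x y psi))) as [[x [psi [-> Hy]]]|Hw].
  - destruct (ctype_add_element U r n (inst x n psi)) as [r' [H1 [H2 [H3 H4]]]]; auto.
    + now apply below_inst_new.
    + intros l Hl.
      destruct (proj1 Hr (fEx x psi :: l ++ map (fun y => fNot (inst x y psi)) (seq 0 n)))
        as [M [v [Hm Hs]]].
      { intros a [<-|Ha]; auto. apply in_app_or in Ha. destruct Ha as [Ha|Ha]; auto.
        apply in_map_iff in Ha. destruct Ha as [y [<- Ha]]. apply in_seq in Ha.
        apply (ctype_not U r _ Hr). apply Hy. lia. }
      destruct (Hs _ (or_introl eq_refl)) as [d Hpsi].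
      exists M, v, d. split; auto. split; [|split].
      * intros a Ha. apply Hs. right. apply in_or_app. auto.
      * intros i Hi E. apply (Hs (fNot (inst x i psi))).
        { right. apply in_or_app. right. apply (in_map (fun y => fNot (inst x y psi))).
          apply in_seq. lia. }
        apply sat_inst. now rewrite E.
      * apply sat_inst. rewrite upd_eq. revert Hpsi. apply sat_ext.
        intros z Hz. destruct (Nat.eq_dec z x) as [->|Hn].
        { now rewrite !upd_eq. }
        rewrite !(upd_neq _ x) by auto. apply upd_neq.
        assert (z < n) by (apply Hb; simpl; auto). lia.
    + exists r'. do 3 (split; [assumption|]).
      intros x' psi' E. injection E as <- <-. eauto.
  (* Nothing has to be witnessed, but a new element is named all the same, so that each call uses
     exactly one variable. *)
  - destruct (ctype_add_element U r n ftrue) as [r' [H1 [H2 [H3 H4]]]]; auto.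
    + intros x. simpl. lia.
    + intros l Hl. destruct (proj1 Hr l Hl) as [M [v [Hm Hs]]].
      destruct (infinite_type_new (dom M) v n (proj2 Hm)) as [d Hdn].
      exists M, v, d. do 3 (split; [assumption|]). apply sat_ftrue.
    + exists r'. do 3 (split; [assumption|]).
      intros x psi ->. apply NNPP. intros N. apply Hw. exists x, psi. split; auto.
      intros y Hy Hry. apply N. exists y. split; [lia|].
      apply H2; auto. now apply below_inst.
Qed.

Lemma ctype_witness_list (U : form -> Prop) (n : nat) (l : list form) : forall r,
  ctype U r -> distinct n r ->
  exists r', ctype U r' /\ (forall a, below n a -> r' a <-> r a) /\
    distinct (n + length l) r' /\
    forall phi, In phi l -> below n phi -> r phi -> witnessed (n + length l) r' phi.
Proof.
  induction l as [|phi l IH]; intros r Hr Hd.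
  - exists r. rewrite Nat.add_0_r. split; [auto|]. split; [tauto|]. split; [auto|]. intros phi [].
  - destruct (IH r Hr Hd) as [r1 [H1 [H2 [H3 H4]]]].
    (* Formulas that call for no witness are replaced by [ftrue], which keeps the number of new
       variables equal to the length of the list. *)
    set (phi' := if excluded_middle_informative (below n phi /\ r phi) then phi else ftrue).
    assert (Hphi' : below n phi' /\ r1 phi').
    { unfold phi'. destruct excluded_middle_informative as [[Hb Hp]|_].
      - split; auto. now apply H2.
      - split; [intros x; simpl; lia|]. apply (ctype_conseq U r1 []); auto.
        + intros a [].
        + intros M v _ _. apply sat_ftrue. }
    destruct (ctype_witness U r1 (n + length l) phi') as [r2 [G1 [G2 [G3 G4]]]]; auto.
    { apply (below_le n); [lia|]. apply Hphi'. }
    { apply Hphi'. }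
    exists r2. simpl. rewrite Nat.add_succ_r. split; auto. split; [|split]; auto.
    + intros a Ha. rewrite G2, H2; auto. tauto. apply (below_le n); auto. lia.
    + intros psi [<-|Hpsi] Hb Hp.
      * unfold phi' in G4. destruct excluded_middle_informative; tauto.
      * intros x chi ->. destruct (H4 _ Hpsi Hb Hp x chi eq_refl) as [y [Hy Hry]].
        exists y. split; [lia|]. apply G2; auto. apply below_inst; auto.
        apply (below_le n); auto. lia.
Qed.

(** * True stages *)

Lemma least_exists (P : nat -> Prop) :
  (exists n, P n) -> exists n, P n /\ forall m, m < n -> ~ P m.
Proof.
  intros [n Hn]. induction n as [n IH] using lt_wf_ind.
  destruct (classic (exists m, m < n /\ P m)) as [[m [H1 H2]]|H].
  - eauto.
  - exists n. split; auto. intros m H1 H2. eauto.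
Qed.

Lemma agree_sym (n : nat) (p q : cantor) : agree n p q -> agree n q p.
Proof. intros H i Hi. symmetry. auto. Qed.

Lemma agree_trans (n : nat) (p q r : cantor) : agree n p q -> agree n q r -> agree n p r.
Proof. intros H1 H2 i Hi. rewrite H1; auto. Qed.

Lemma agree_less (m n : nat) (p q : cantor) : m <= n -> agree n p q -> agree m p q.
Proof. intros H1 H2 i Hi. apply H2. lia. Qed.

(** Membership follows from the first [s] bits together with the claim that [s] is a true stage. At
    level 0 the claim is void, and forcing means that a basic neighbourhood lies in [A]. *)
Definition forces (R : cantor -> nat -> Prop) (A : cantor -> Prop) (p : cantor) (s : nat) : Prop :=
  forall q, agree s p q -> R q s -> A q.

Definition newly (L : cantor -> nat -> nat -> Prop) (R : cantor -> nat -> Prop)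
    (A : cantor -> Prop) (p : cantor) (s : nat) : Prop :=
  forces R A p s /\ forall t, t < s -> L p t s -> ~ forces R A p t.

(* [act L R fam p s i] says that the true-stage number of [s] (the least index of
   a set newly forced at [s], capped by [s] itself) is at most [i]. One level up,
   [s] precedes [u] when no stage in between has a smaller number than [s]. *)
Definition act (L : cantor -> nat -> nat -> Prop) (R : cantor -> nat -> Prop)
    (fam : nat -> cantor -> Prop) (p : cantor) (s i : nat) : Prop :=
  s <= i \/ exists j, j <= i /\ newly L R (fam j) p s.

(** Order and truth are defined together because [act] refers to both one level below. A true stage
    is one that precedes infinity: no later true stage of the lower level has a smaller number. *)
Fixpoint stage_sys (fam : nat -> cantor -> Prop) (k : nat) :
    (cantor -> nat -> nat -> Prop) * (cantor -> nat -> Prop) :=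
  match k with
  | 0 => (fun _ s t => s <= t, fun _ _ => True)
  | S k =>
      let L := fst (stage_sys fam k) in
      let R := snd (stage_sys fam k) in
      (fun p s u => L p s u /\ forall t, L p s t -> L p t u ->
         forall i, act L R fam p t i -> act L R fam p s i,
       fun p s => R p s /\ forall t, s <= t -> R p t ->
         forall i, act L R fam p t i -> act L R fam p s i)
  end.

Definition sle (fam : nat -> cantor -> Prop) (k : nat) := fst (stage_sys fam k).
Definition strue (fam : nat -> cantor -> Prop) (k : nat) := snd (stage_sys fam k).
Definition sact (fam : nat -> cantor -> Prop) (k : nat) :=
  act (sle fam k) (strue fam k) fam.

Lemma sle_S (fam : nat -> cantor -> Prop) (k : nat) (p : cantor) (s u : nat) :
  sle fam (S k) p s u <-> sle fam k p s u /\
    forall t, sle fam k p s t -> sle fam k p t u ->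
      forall i, sact fam k p t i -> sact fam k p s i.
Proof. reflexivity. Qed.

Lemma strue_S (fam : nat -> cantor -> Prop) (k : nat) (p : cantor) (s : nat) :
  strue fam (S k) p s <-> strue fam k p s /\
    forall t, s <= t -> strue fam k p t ->
      forall i, sact fam k p t i -> sact fam k p s i.
Proof. reflexivity. Qed.

Section Stages.
Context (fam : nat -> cantor -> Prop).
Local Notation le := (sle fam).
Local Notation tr := (strue fam).

Lemma sle_less (k : nat) (p : cantor) (s t : nat) : le k p s t -> s <= t.
Proof. induction k; simpl; auto. intros H. apply IHk, H. Qed.

Lemma sle_refl (k : nat) (p : cantor) (s : nat) : le k p s s.
Proof.
  induction k as [|k IH]; [apply le_n|]. rewrite sle_S. split; auto.
  intros t H1 H2. apply sle_less in H1, H2. now replace t with s by lia.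
Qed.

(** Joint induction: for transitivity one level up, a stage between [s] and [u] has to be compared
    with [t], and the tree property of the lower level puts both on one chain. *)
Lemma sle_trans_tree (k : nat) (p : cantor) :
  (forall s t u, le k p s t -> le k p t u -> le k p s u) /\
  (forall s t u, le k p s u -> le k p t u -> s <= t -> le k p s t).
Proof.
  induction k as [|k [IHt IHr]].
  - split; simpl; unfold sle; simpl; lia.
  - split.
    + intros s t u H1 H2. rewrite sle_S in H1, H2. rewrite sle_S. split.
      * apply (IHt s t u); tauto.
      * intros w Hw1 Hw2 i Hi. destruct (Nat.le_gt_cases w t) as [Hl|Hl].
        { apply (proj2 H1 w); auto. apply (IHr w t u); tauto. }
        assert (le k p t w) by (apply (IHr t w u); try tauto; lia).
        apply (proj2 H1 t); try tauto. { apply sle_refl. }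
        now apply (proj2 H2 w).
    + intros s t u H1 H2 H3. rewrite sle_S in H1, H2. rewrite sle_S. split.
      * apply (IHr s t u); tauto.
      * intros w Hw1 Hw2. apply (proj2 H1 w); auto. apply (IHt w t u); tauto.
Qed.

Lemma sle_trans (k : nat) (p : cantor) (s t u : nat) :
  le k p s t -> le k p t u -> le k p s u.
Proof. apply sle_trans_tree. Qed.

Lemma sle_tree (k : nat) (p : cantor) (s t u : nat) :
  le k p s u -> le k p t u -> s <= t -> le k p s t.
Proof. apply sle_trans_tree. Qed.

Lemma sle_mono (j k : nat) (p : cantor) (s t : nat) : j <= k -> le k p s t -> le j p s t.
Proof. induction 1 as [|k H IH]; auto. intros H1. rewrite sle_S in H1. tauto. Qed.

(** At level [k] the stages between [s] and [t] are also between [s] and [u], so the comparison of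
    numbers is inherited. *)
Lemma sle_interp (k : nat) (p : cantor) (s t u : nat) :
  le (S k) p s u -> le k p t u -> s <= t -> le (S k) p s t.
Proof.
  intros H1 H2 H3. rewrite sle_S in H1. rewrite sle_S. split.
  - apply (sle_tree k p s t u); tauto.
  - intros w Hw1 Hw2. apply (proj2 H1); auto. now apply (sle_trans k p w t).
Qed.

Lemma strue_mono (j k : nat) (p : cantor) (s : nat) : j <= k -> tr k p s -> tr j p s.
Proof. induction 1 as [|k H IH]; auto. intros H1. rewrite strue_S in H1. tauto. Qed.

Lemma strue_sle (k : nat) (p : cantor) :
  (forall s t, le k p s t -> tr k p t -> tr k p s) /\
  (forall s t, tr k p s -> tr k p t -> s <= t -> le k p s t).
Proof.
  induction k as [|k [IHd IHc]].
  - split; intros; [exact I | assumption].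
  - split.
    + intros s u H1 H2. rewrite sle_S in H1. rewrite strue_S in H2.
      destruct H1 as [H1 H1']. destruct H2 as [H2 H2'].
      rewrite strue_S. split; [now apply (IHd s u)|].
      intros t Hst Ht i Hi. destruct (Nat.le_gt_cases t u) as [Hl|Hl].
      * apply (H1' t); auto. apply IHc; auto. now apply (IHd s u).
      * apply (H1' u H1 (sle_refl k p u)), (H2' t); auto; lia.
    + intros s t Hs Ht Hst. rewrite strue_S in Hs, Ht. rewrite sle_S. split.
      * apply IHc; tauto.
      * intros w Hw1 Hw2. apply (proj2 Hs).
        { now apply sle_less in Hw1. }
        apply (IHd w t); tauto.
Qed.

Lemma strue_down (k : nat) (p : cantor) (s t : nat) : le k p s t -> tr k p t -> tr k p s.
Proof. apply strue_sle. Qed.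

Lemma strue_chain (k : nat) (p : cantor) (s t : nat) :
  tr k p s -> tr k p t -> s <= t -> le k p s t.
Proof. apply strue_sle. Qed.

Lemma forces_local (R : cantor -> nat -> Prop) (A : cantor -> Prop) (p q : cantor) (s : nat) :
  agree s p q -> forces R A p s -> forces R A q s.
Proof. intros H F r Hr. apply F. now apply (agree_trans s p q r). Qed.

(** Forcing at [s] quantifies over all inputs extending the first [s] bits, true stages included, so
    only the order could look further; its locality is a hypothesis because the order one level up
    is defined from [sact]. *)
Lemma sact_local_of (k : nat) :
  (forall p q s t, agree t p q -> le k p s t -> le k q s t) ->
  forall p q s i, agree s p q -> sact fam k p s i -> sact fam k q s i.
Proof.
  intros HL p q s i Ha [H|[j [Hj [Hf Hn]]]]; [now left|].
  right. exists j. split; auto. split; [now apply (forces_local _ _ p)|].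
  intros t Ht Hle Hf'.
  assert (Hat : agree t q p) by (apply agree_sym, (agree_less t s); auto; lia).
  apply (Hn t Ht).
  - now apply (HL q p); auto using agree_sym.
  - now apply (forces_local _ _ q).
Qed.

Lemma sle_local (k : nat) : forall p q s t, agree t p q -> le k p s t -> le k q s t.
Proof.
  induction k as [|k IH]; intros p q s u Ha H; [exact H|].
  rewrite sle_S in H. destruct H as [H1 H2]. rewrite sle_S.
  split; [now apply (IH p q)|]. intros t Ht1 Ht2 i Hi.
  assert (Ltu : t <= u) by now apply sle_less in Ht2.
  assert (Lst : s <= t) by now apply sle_less in Ht1.
  apply (sact_local_of k IH p q); [apply (agree_less s u); auto; lia|].
  apply (H2 t).
  - apply (IH q p); auto. now apply agree_sym, (agree_less t u).
  - apply (IH q p); auto. now apply agree_sym.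
  - apply (sact_local_of k IH q p); auto. now apply agree_sym, (agree_less t u).
Qed.

Lemma sact_local (k : nat) (p q : cantor) (s i : nat) :
  agree s p q -> sact fam k p s i -> sact fam k q s i.
Proof. apply sact_local_of, sle_local. Qed.

Lemma sact_mono (k : nat) (p : cantor) (s i j : nat) :
  i <= j -> sact fam k p s i -> sact fam k p s j.
Proof.
  intros H [H1|[n [H1 H2]]]; [left; lia|]. right. exists n. split; auto. lia.
Qed.

(** Among the level-[k] true stages from [N] on, one with the least number is true at the next
    level; the cap in [act] guarantees that numbers exist. *)
Lemma strue_unbounded (k : nat) (p : cantor) : forall N, exists s, N <= s /\ tr k p s.
Proof.
  induction k as [|k IH]; intros N.
  - exists N. split; [lia | exact I].
  - destruct (least_exists (fun i => exists t, N <= t /\ tr k p t /\ sact fam k p t i))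
      as [i [[s [H1 [H2 H3]]] Hm]].
    + destruct (IH N) as [t [Ht1 Ht2]]. exists t, t. split; auto. split; auto.
      left. lia.
    + exists s. split; auto. rewrite strue_S. split; auto.
      intros t Hst Ht j Hj. apply (sact_mono k p s i); auto.
      apply Nat.nlt_ge. intros Hij. apply (Hm j Hij). exists t. split; [lia | auto].
Qed.

(* Each set is newly forced at most once along the true stages. *)
Lemma sact_eventually_large (k : nat) (p : cantor) (i : nat) :
  exists N, forall t, N <= t -> tr k p t -> ~ sact fam k p t i.
Proof.
  assert (U : forall j, exists N, forall t, N <= t -> tr k p t ->
            ~ newly (le k) (tr k) (fam j) p t).
  { intros j. destruct (classic (exists s, tr k p s /\ newly (le k) (tr k) (fam j) p s))
      as [[s [Hs [Hn _]]]|H].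
    - exists (S s). intros t Hst Ht [_ Hn']. apply (Hn' s); auto.
      apply strue_chain; auto. lia.
    - exists 0. intros t _ Ht Hn. eauto. }
  assert (V : exists N, forall t, N <= t -> tr k p t ->
            forall j, j <= i -> ~ newly (le k) (tr k) (fam j) p t).
  { induction i as [|i [N IH]].
    - destruct (U 0) as [N HN]. exists N. intros t H1 H2 j Hj.
      replace j with 0 by lia. auto.
    - destruct (U (S i)) as [N' HN']. exists (max N N'). intros t H1 H2 j Hj.
      destruct (Nat.eq_dec j (S i)) as [->|Hji].
      + apply HN'; auto. lia.
      + apply IH; auto; lia. }
  destruct V as [N HN]. exists (max N (S i)). intros t H1 H2 [H3|[j [H3 H4]]].
  - lia.
  - apply (HN t) in H4; auto. lia.
Qed.

Definition open_at (k : nat) (A : cantor -> Prop) : Prop :=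
  forall p, A p -> exists s, tr k p s /\ forces (tr k) A p s.

(** Take a true stage [s] of [p] with number above [i]. Suppose some [q] in [fam i] agrees up to [s]
    and has [s] as a true stage, and let [t] be the first true stage of [q] forcing [fam i]. If
    [t >= s], then [t] has number at most [i] and undercuts [s]. If [t < s], the forcing is visible
    from [p] and puts [p] into [fam i]. *)
Lemma open_at_compl (k i : nat) : open_at k (fam i) -> open_at (S k) (fun p => ~ fam i p).
Proof.
  intros Ho p Hp.
  destruct (sact_eventually_large k p i) as [N HN].
  destruct (strue_unbounded (S k) p N) as [s [Hs1 Hs2]].
  pose proof (proj1 (proj1 (strue_S fam k p s) Hs2)) as Hs3.
  exists s. split; auto. intros q Hq Hqs Hqi.
  destruct (least_exists (fun t => tr k q t /\ forces (tr k) (fam i) q t))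
    as [t [[Ht1 Ht2] Hm]]; auto.
  destruct (Nat.le_gt_cases s t) as [Hst|Hst].
  - apply (HN s); auto. apply (sact_local k q p); [now apply agree_sym|].
    rewrite strue_S in Hqs. apply (proj2 Hqs t); auto.
    right. exists i. split; auto. split; auto.
    intros t' Hlt Hle Hf. apply (Hm t' Hlt). split; auto. now apply (strue_down k q t' t).
  - apply Hp, Ht2.
    + apply agree_sym, (agree_less t s); auto. lia.
    + apply (strue_down k p t s); auto.
      apply (sle_local k q p); [now apply agree_sym|].
      apply strue_chain; auto; [|lia]. rewrite strue_S in Hqs; tauto.
Qed.

Lemma forces_later (k : nat) (A : cantor -> Prop) (p : cantor) (s t : nat) :
  tr k p s -> tr k p t -> s <= t -> forces (tr k) A p s -> forces (tr k) A p t.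
Proof.
  intros Hs Ht Hst F q Hq Hqt. apply F.
  - now apply (agree_less s t).
  - apply (strue_down k q s t); auto. apply (sle_local k p q); auto.
    now apply strue_chain.
Qed.

End Stages.

(** * Borel sets of finite level along true stages *)

Lemma Sigma_iff (n : nat) (A B : cantor -> Prop) :
  (forall x, A x <-> B x) -> Sigma n A -> Sigma n B.
Proof.
  intros H. replace B with A; auto. extensionality x. now apply propositional_extensionality.
Qed.

(* Like [Sigma n (fam i)], but all sets of the witnessing tree lie in [fam]: the
   countable family for which the true stages are built. *)
Fixpoint witnessed_Sigma (fam : nat -> cantor -> Prop) (n i : nat) : Prop :=
  match n with
  | 0 => False
  | S m =>
      match m with
      | 0 => open_set (fam i)
      | S _ => exists e : nat -> nat, (forall k, witnessed_Sigma fam m (e k)) /\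
          forall x, fam i x <-> exists k, ~ fam (e k) x
      end
  end.

Lemma witnessed_Sigma_reindex (fam fam' : nat -> cantor -> Prop) (r : nat -> nat) :
  (forall i, fam' (r i) = fam i) ->
  forall n i, witnessed_Sigma fam n i -> witnessed_Sigma fam' n (r i).
Proof.
  intros H. induction n as [|[|n] IH]; intros i Hi.
  - exact Hi.
  - simpl in *. now rewrite H.
  - destruct Hi as [e [H1 H2]]. exists (fun k => r (e k)). split.
    + intros k. now apply IH.
    + intros x. rewrite H, H2. split; intros [k Hk]; exists k; revert Hk; now rewrite H.
Qed.

Definition join_fam (f : nat -> nat -> cantor -> Prop) (c : nat) : cantor -> Prop :=
  f (fst (Cantor.of_nat c)) (snd (Cantor.of_nat c)).

Lemma join_fam_at (f : nat -> nat -> cantor -> Prop) (i j : nat) :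
  join_fam f (Cantor.to_nat (i, j)) = f i j.
Proof. unfold join_fam. now rewrite Cantor.cancel_of_to. Qed.

Lemma Sigma_family (n : nat) : forall A, Sigma n A ->
  exists fam, fam 0 = A /\ witnessed_Sigma fam n 0.
Proof.
  induction n as [|[|n] IH]; intros A HA.
  - destruct HA.
  - exists (fun _ => A). split; auto.
  - destruct HA as [B [H1 H2]].
    destruct (choice (fun k f => f 0 = (fun x => ~ B k x) /\ witnessed_Sigma f (S n) 0))
      as [f Hf].
    { intros k. apply (IH _ (H1 k)). }
    (* Row 0 holds [A], row [S k] the tree of the complement of [B k]. Since the pair (0, 0) has
       code 0, the root keeps index 0. *)
    set (g := fun i => match i with 0 => fun _ : nat => A | S k => f k end).
    exists (join_fam g). split.
    + change 0 with (Cantor.to_nat (0, 0)). now rewrite join_fam_at.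
    + exists (fun k => Cantor.to_nat (S k, 0)). split.
      * intros k. apply (witnessed_Sigma_reindex (f k) _ (fun j => Cantor.to_nat (S k, j))).
        { intros i. now rewrite join_fam_at. }
        apply Hf.
      * intros x. change 0 with (Cantor.to_nat (0, 0)) at 1. rewrite join_fam_at.
        change (g 0 0 x) with (A x). rewrite H2.
        split; intros [k Hk]; exists k; revert Hk; rewrite join_fam_at; simpl;
          rewrite (proj1 (Hf k)); tauto.
Qed.

Lemma witnessed_Sigma_open (fam : nat -> cantor -> Prop) (n : nat) : forall i,
  witnessed_Sigma fam (S n) i -> open_at fam n (fam i).
Proof.
  induction n as [|n IH]; intros i Hi p Hp.
  - destruct (Hi p Hp) as [s Hs]. exists s. split; [exact I|]. intros q Hq _. auto.
  - destruct Hi as [e [H1 H2]]. apply H2 in Hp. destruct Hp as [k Hk].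
    destruct (open_at_compl fam n (e k) (IH _ (H1 k)) p Hk) as [s [Hs1 Hs2]].
    exists s. split; auto. intros q Hq Hqs. apply H2. exists k. now apply Hs2.
Qed.

Lemma PiOmega_open_compl (P : cantor -> Prop) : PiOmega P ->
  exists fam (B : nat -> cantor -> Prop) (lev : nat -> nat),
    (forall x, P x <-> forall k, B k x) /\
    forall k, open_at fam (lev k) (fun x => ~ B k x).
Proof.
  intros [B [lev [H1 H2]]].
  destruct (choice (fun k f => f 0 = B k /\ witnessed_Sigma f (lev k) 0)) as [f Hf].
  { intros k. apply (Sigma_family _ _ (H1 k)). }
  exists (join_fam f), B, lev. split; auto. intros k.
  (* As [Sigma 0] is empty, [lev k] is some [S n]: the set is open at level [n], hence its
     complement at level [S n]. *)
  destruct (Hf k) as [E W]. destruct (lev k) as [|n]; [destruct W|].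
  rewrite <- E, <- (join_fam_at f k 0). apply open_at_compl, witnessed_Sigma_open.
  apply (witnessed_Sigma_reindex (f k) _ (fun j => Cantor.to_nat (k, j))); auto.
  intros i. now rewrite join_fam_at.
Qed.

(** * Guessing the theory *)

Section Guess.
Context (fam : nat -> cantor -> Prop) (B : nat -> cantor -> Prop) (lev : nat -> nat).
Context (T : form -> Prop) (Ts : nat -> form -> Prop).
Local Notation le := (sle fam).
Local Notation tr := (strue fam).

(* The bound [L <= s] makes a declaration at stage [s] visible at all levels from
   [s] on, while below level [s] the theories [T] and [Ts (S s)] agree. *)
Definition declares (p : cantor) (s L : nat) : Prop :=
  L <= s /\ exists k, lev k = L /\ forces (tr L) (fun x => ~ B k x) p s.

Definition candidate (p : cantor) (u s : nat) : Prop :=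
  exists L, declares p s L /\ le L p s u.

Definition first_candidate (p : cantor) (u s : nat) : Prop :=
  candidate p u s /\ forall t, t < s -> ~ candidate p u t.

(** The earliest declaration still standing decides, so that the guess settles once the first
    correct one is reached. The shift to [S s] gains one level of agreement with [T] over the stage
    index. *)
Definition guess (p : cantor) (u : nat) : form -> Prop := fun phi =>
  (exists s, first_candidate p u s /\ Ts (S s) phi) \/
  ((forall s, ~ candidate p u s) /\ T phi).

Lemma guess_first (p : cantor) (u s : nat) : first_candidate p u s -> guess p u = Ts (S s).
Proof.
  intros [H1 H2]. extensionality phi. apply propositional_extensionality. split.
  - intros [[t [[Ht1 Ht2] H]]|[H _]]; [|destruct (H s H1)].
    assert (t = s) as ->; auto.
    destruct (Nat.lt_trichotomy t s) as [Hl|[Hl|Hl]]; auto.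
    + destruct (H2 t Hl Ht1).
    + destruct (Ht2 s Hl H1).
  - intros H. left. exists s. repeat split; auto.
Qed.

Lemma guess_none (p : cantor) (u : nat) : (forall s, ~ candidate p u s) -> guess p u = T.
Proof.
  intros H. extensionality phi. apply propositional_extensionality. split.
  - intros [[t [[Ht1 Ht2] _]]|[_ H']]; auto. destruct (H t Ht1).
  - intros H'. right. auto.
Qed.

Lemma guess_cases (p : cantor) (u : nat) :
  (exists s, first_candidate p u s /\ guess p u = Ts (S s)) \/
  ((forall s, ~ candidate p u s) /\ guess p u = T).
Proof.
  destruct (classic (exists s, candidate p u s)) as [H|H].
  - left. destruct (least_exists _ H) as [s Hs]. exists s. split; auto.
    now apply guess_first.
  - right. assert (N : forall s, ~ candidate p u s) by eauto. split; auto.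
    now apply guess_none.
Qed.

Lemma candidate_local (p q : cantor) (u s : nat) :
  agree u p q -> candidate p u s -> candidate q u s.
Proof.
  intros Ha [L [[H1 [k [H2 H3]]] H4]]. exists L. split.
  - split; auto. exists k. split; auto. apply (forces_local _ _ p); auto.
    apply (agree_less s u); auto. now apply sle_less in H4.
  - now apply (sle_local fam L p q).
Qed.

Lemma guess_local (p q : cantor) (u : nat) : agree u p q -> guess p u = guess q u.
Proof.
  intros Ha.
  assert (E : forall s, candidate p u s <-> candidate q u s).
  { intros s. split; apply candidate_local; auto. now apply agree_sym. }
  destruct (guess_cases p u) as [[s [[H1 H2] ->]]|[H ->]].
  - symmetry. apply guess_first. split; [now apply E|].
    intros t Ht. rewrite <- E. auto.
  - symmetry. apply guess_none. intros s. rewrite <- E. auto.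
Qed.

(** A declaration at [c] has level at most [c < j], so it passes from [s] to [u] by transitivity and
    back by the tree property. *)
Lemma candidate_below (p : cantor) (j s u c : nat) : le j p s u -> j <= s -> c < j ->
  candidate p s c <-> candidate p u c.
Proof.
  intros H Hj Hc. split; intros [L [HD HL]]; exists L; (split; auto); destruct HD as [HD _].
  - apply (sle_trans fam L p c s); auto. apply (sle_mono fam L j); auto. lia.
  - apply (sle_tree fam L p c s u); auto; [|lia]. apply (sle_mono fam L j); auto. lia.
Qed.

Lemma guess_agree (hagree : forall n phi, ExF n phi -> (T phi <-> Ts n phi))
    (p : cantor) (j s u : nat) (phi : form) :
  le j p s u -> j <= s -> ExF (S j) phi -> guess p s phi <-> guess p u phi.
Proof.
  intros Hle Hj Hphi.
  assert (HT : forall c, j <= c -> Ts (S c) phi <-> T phi).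
  { intros c Hc. symmetry. apply hagree. apply (ExF_mono (S j)); auto. lia. }
  assert (first : forall c, c < j -> first_candidate p s c <-> first_candidate p u c).
  { intros c Hc. unfold first_candidate. rewrite (candidate_below p j s u c); auto.
    split; intros [H1 H2]; split; auto; intros t Ht; specialize (H2 t Ht);
      rewrite (candidate_below p j s u t) in *; auto; lia. }
  assert (high : forall v, (forall c, c < j -> ~ first_candidate p v c) ->
             guess p v phi <-> T phi).
  { intros v Hv. destruct (guess_cases p v) as [[c [Hc ->]]|[_ ->]]; [|tauto].
    apply HT. apply Nat.nlt_ge. intros Hl. apply (Hv c Hl Hc). }
  destruct (classic (exists c, c < j /\ first_candidate p s c)) as [[c [Hc Hf]]|N].
  - rewrite (guess_first p s c Hf), (guess_first p u c); [tauto | now apply first].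
  - rewrite !high; [tauto| |]; intros c Hc Hf; apply N; exists c; split; auto.
    now apply first.
Qed.

(** At a level-[i] true stage, a declaration made before stage [i] would itself sit at a true stage
    and force [p] out of some [B k]. So any declaration in force has index at least [i]. *)
Lemma guess_in (hagree : forall n phi, ExF n phi -> (T phi <-> Ts n phi))
    (p : cantor) (i s : nat) (phi : form) :
  (forall k, B k p) -> tr i p s -> ExF i phi -> guess p s phi <-> T phi.
Proof.
  intros Hp Hs Hphi. destruct (guess_cases p s) as [[c [Hc ->]]|[_ ->]]; [|tauto].
  symmetry. apply hagree. apply (ExF_mono i); auto.
  destruct Hc as [[L [[H1 [k [H2 H3]]] H4]] _].
  apply Nat.nlt_ge. intros Hl. apply (H3 p); auto.
  - intros x _. reflexivity.
  - apply (strue_down fam L p c s); auto. apply (strue_mono fam L i); auto. lia.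
Qed.

Lemma guess_out (HB : forall k, open_at fam (lev k) (fun x => ~ B k x)) (p : cantor) :
  ~ (forall k, B k p) ->
  exists c m, forall s, m <= s -> tr m p s -> guess p s = Ts (S c).
Proof.
  intros Hp. apply not_all_ex_not in Hp. destruct Hp as [k Hk].
  destruct (least_exists (fun s => exists L, declares p s L /\ tr L p s))
    as [c [[L [[H1 H2] H3]] Hm]].
  - destruct (HB k p Hk) as [s [Hs1 Hs2]].
    (* The forcing stage is replaced by a later true one past [lev k], where a declaration of that
       level is permitted. *)
    destruct (strue_unbounded fam (lev k) p (max s (lev k))) as [t [Ht1 Ht2]].
    exists t, (lev k). split; auto. split; [lia|]. exists k. split; auto.
    apply (forces_later fam (lev k) _ p s t); auto. lia.
  (* All declarations up to [c] have level at most [c]. At a true stage of level [S c], any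
     candidate before [c] would thus be a truly made declaration, against the minimality of [c]. *)
  - exists c, (S c). intros s Hs Ht. apply guess_first. split.
    + exists L. split; [now split|]. apply strue_chain; auto; [|lia].
      apply (strue_mono fam L (S c)); auto.
    + intros t Htc [L' [Hd Hle]]. apply (Hm t Htc). exists L'. split; auto.
      apply (strue_down fam L' p t s); auto. apply (strue_mono fam L' (S c)); auto.
      destruct Hd. lia.
Qed.

End Guess.

(** * The construction by stages *)

Lemma greatest_exists (P : nat -> Prop) (u : nat) :
  (exists s, P s) -> (forall s, P s -> s < u) -> exists s, P s /\ forall t, P t -> t <= s.
Proof.
  intros [s0 H0] Hu.
  destruct (least_exists (fun m => forall s, P s -> s < m)) as [[|m] [H1 H2]]; eauto.
  - specialize (H1 s0 H0). lia.
  - apply NNPP. intros N. apply (H2 m); auto. intros s Hs.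
    destruct (Nat.eq_dec s m) as [->|].
    + exfalso. apply N. exists m. split; auto. intros t Ht. specialize (H1 t Ht). lia.
    + specialize (H1 s Hs). lia.
Qed.

(** Stage [u] commits [u] new variables, one for each formula [e n] with [n < u]. *)
Fixpoint len (u : nat) : nat :=
  match u with 0 => 0 | S t => len t + S t end.

Lemma len_mono (s t : nat) : s <= t -> len s <= len t.
Proof. induction 1; simpl; lia. Qed.

Lemma le_len (u : nat) : u <= len u.
Proof. induction u; simpl; lia. Qed.

Lemma len_pred (u : nat) : len u = len (pred u) + u.
Proof. destruct u; simpl; lia. Qed.

Section Construction.
Context (voc : vocabulary) (fam : nat -> cantor -> Prop).
Context (U : cantor -> nat -> form -> Prop).
Context (HUc : forall p u, complete_theory voc (U p u)).
Context (HUinf : forall p u, has_infinite_model (U p u)).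
Context (HUloc : forall p q u, agree u p q -> U p u = U q u).
Context (HUag : forall p j s u phi, sle fam j p s u -> j <= s -> ExF (S j) phi ->
  U p s phi <-> U p u phi).
Context (e : nat -> form) (He : forall phi, exists n, e n = phi).
Local Notation le := (sle fam).
Local Notation tr := (strue fam).

(** The guard [k <= s] leaves finitely many levels at each stage and is the range in which the
    guesses are known to agree. Witnesses are demanded for formulas in the variables committed
    before stage [u]. *)
Definition good (p : cantor) (u : nat) (h : nat -> form -> Prop) (r : form -> Prop) : Prop :=
  ctype (U p u) r /\
  (forall k s, s < u -> k <= s -> le k p s u -> agree_at voc k (len s) (h s) r) /\
  distinct (len u) r /\
  (forall n, n < u -> below (len (pred u)) (e n) -> r (e n) -> witnessed (len u) r (e n)).

(** The base for amalgamation when no committed variable is shared: on sentences, complete types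
    reduce to their theories. *)
Lemma agree_at_sentences (p : cantor) (k s u : nat) (r q : form -> Prop) :
  ctype (U p u) r -> ctype (U p s) q -> le k p s u -> k <= s -> agree_at voc (S k) 0 r q.
Proof.
  intros Hr Hq Hle Hk phi W [psi [L [W' [F S]]]] Hb.
  assert (Hpsi : sentence voc psi).
  { split; auto. intros x Hx. apply F, Hb in Hx. lia. }
  rewrite <- (ctype_equiv _ r psi phi Hr), <- (ctype_equiv _ q psi phi Hq); auto.
  rewrite (ctype_sentence voc _ r psi (HUc p u) Hr), (ctype_sentence voc _ q psi (HUc p s) Hq);
    auto.
  symmetry. now apply (HUag p k).
Qed.

(* Downward induction on the level: with [s_k] the last stage before [u] that is
   a [k]-predecessor of [u], a type good for all levels above [k] agrees at level
   [k+1] with the type at [s_k], because [s_(k+1)] precedes [s_k] at level [k+1]. *)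
Lemma good_levels (p : cantor) (u : nat) (h : nat -> form -> Prop) :
  (forall s, s < u -> good p s h (h s)) ->
  forall d k, k + d = u -> exists r, ctype (U p u) r /\
    forall j s, k <= j -> s < u -> j <= s -> le j p s u -> agree_at voc j (len s) (h s) r.
Proof.
  intros Hg. induction d as [|d IH]; intros k Hkd.
  (* At level [u] no condition is left, since [u <= j <= s < u] is impossible. *)
  - destruct (ctype_exists (U p u) (HUinf p u)) as [r Hr]. exists r. split; auto. lia.
  - destruct (IH (S k)) as [r [Hr Hl]]; [lia|].
    set (P := fun j s => s < u /\ j <= s /\ le j p s u).
    destruct (classic (exists s, P k s)) as [Hex|N].
    2: { exists r. split; auto. intros j s Hj Hs Hjs Hle.
         destruct (Nat.eq_dec j k) as [->|].
         - exfalso. apply N. exists s. now repeat split.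
         - apply Hl; auto. lia. }
    destruct (greatest_exists (P k) u Hex) as [sk [[S1 [S2 S3]] Smax]].
    { intros s Hs. apply Hs. }
    assert (exists a, agree_at voc (S k) a r (h sk) /\
              forall s, P (S k) s -> len s <= a) as [a [Ha Hamax]].
    { destruct (classic (exists s, P (S k) s)) as [Hex'|N'].
      - destruct (greatest_exists (P (S k)) u Hex') as [t [[T1 [T2 T3]] Tmax]].
        { intros s Hs. apply Hs. }
        exists (len t). split.
        + assert (Hts : t <= sk).
          { apply Smax. split; auto. split; [lia|]. apply (sle_mono fam k (S k)); auto. }
          apply (agree_at_trans _ _ _ _ (h t)).
          * apply agree_at_sym. apply Hl; auto.
          * destruct (Nat.eq_dec t sk) as [->|Hne].
            { intros phi _ _ _. tauto. }
            apply (Hg sk S1); auto; [lia|]. apply (sle_interp fam k p t sk u); auto.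
        + intros s Hs. apply len_mono. now apply Tmax.
      (* Without a predecessor at level [S k] no variable has to be kept, and agreement on sentences
         suffices. *)
      - exists 0. split.
        + apply (agree_at_sentences p k sk u); auto. apply (Hg sk S1).
        + intros s Hs. exfalso. eauto. }
    destruct (ctype_amalgam voc (U p u) (U p sk) r (h sk) k a (len sk))
      as [r' [R1 [R2 R3]]]; auto.
    { apply (Hg sk S1). }
    exists r'. split; auto. intros j s Hj Hs Hjs Hle.
    destruct (Nat.eq_dec j k) as [->|Hne].
    + assert (Hss : s <= sk) by (apply Smax; now repeat split).
      apply (agree_at_trans _ _ _ _ (h sk)).
      * destruct (Nat.eq_dec s sk) as [->|Hne]; [intros phi _ _ _; tauto|].
        apply (Hg sk S1); auto; [lia|]. apply (sle_tree fam k p s sk u); auto.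
      * apply agree_at_sym. apply (agree_at_le voc k k _ (len sk)); auto.
        now apply len_mono.
    (* Predecessors at higher levels are predecessors at level [S k], so their variables lie below
       [a], where the amalgam changed nothing. *)
    + apply (agree_at_trans _ _ _ _ r); [apply Hl; auto; lia|].
      intros phi W L B. symmetry. apply R2.
      apply (below_le (len s)); auto. apply Hamax. split; auto. split; [lia|].
      apply (sle_mono fam (S k) j); auto. lia.
Qed.

Lemma good_exists (p : cantor) (u : nat) (h : nat -> form -> Prop) :
  (forall s, s < u -> good p s h (h s)) -> exists r, good p u h r.
Proof.
  intros Hg. destruct (good_levels p u h Hg u 0 eq_refl) as [r [Hr Hl]].
  (* Inequalities are quantifier-free, so they pass on from the preceding stage, which is always a
     predecessor at level 0. *)
  assert (Hd : distinct (len (pred u)) r).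
  { destruct u as [|t]; simpl.
    - intros i j Hi Hj. simpl in Hj. lia.
    - intros i j Hi Hj. apply (Hl 0 t); auto; try lia.
      + unfold sle. simpl. lia.
      + exact I.
      + now apply low_qf.
      + intros x. simpl. lia.
      + destruct (Hg t (Nat.lt_succ_diag_r t)) as [_ [_ [Hd _]]]. auto. }
  destruct (ctype_witness_list (U p u) (len (pred u)) (map e (seq 0 u)) r Hr Hd)
    as [r' [H1 [H2 [H3 H4]]]].
  rewrite length_map, length_seq, <- len_pred in H3, H4.
  exists r'. split; auto. split; [|split]; auto.
  - intros k s Hs Hks Hle. apply (agree_at_trans _ _ _ _ r); [apply Hl; auto; lia|].
    intros phi W L B. symmetry. apply H2.
    apply (below_le (len s)); auto. apply len_mono. lia.
  - intros n Hn B Hr'. apply H4; auto.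
    + apply in_map, in_seq. lia.
    + now apply H2.
Qed.

Lemma good_ext (p q : cantor) (u : nat) (h h' : nat -> form -> Prop) (r : form -> Prop) :
  agree u p q -> (forall s, s < u -> h s = h' s) -> good p u h r -> good q u h' r.
Proof.
  intros Ha Hh [H1 [H2 H3]]. split; [|split]; auto.
  - now rewrite <- (HUloc p q u Ha).
  - intros k s Hs Hks Hle. rewrite <- (Hh s Hs). apply H2; auto.
    apply (sle_local fam k q p); auto using agree_sym.
Qed.

Fixpoint history (p : cantor) (n : nat) : nat -> form -> Prop :=
  match n with
  | 0 => fun _ _ => False
  | S m => fun i =>
      if Nat.eqb i m
      then epsilon (inhabits (fun _ : form => False)) (good p m (history p m))
      else history p m i
  end.

Definition stype (p : cantor) (u : nat) : form -> Prop := history p (S u) u.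

Lemma history_stype (p : cantor) (n i : nat) : i < n -> history p n i = stype p i.
Proof.
  induction 1 as [|n Hn IH]; auto.
  change (history p (S n) i) with (if Nat.eqb i n
    then epsilon (inhabits (fun _ : form => False)) (good p n (history p n))
    else history p n i).
  destruct (Nat.eqb_spec i n); auto. lia.
Qed.

Lemma stype_good (p : cantor) (u : nat) : good p u (stype p) (stype p u).
Proof.
  induction u as [u IH] using lt_wf_ind.
  destruct (good_exists p u (stype p) IH) as [r Hr].
  apply (good_ext p p u (history p u)).
  - intros i _. reflexivity.
  - intros s Hs. now apply history_stype.
  - unfold stype. simpl. rewrite Nat.eqb_refl. apply epsilon_spec. exists r.
    apply (good_ext p p u (stype p)); auto.
    + intros i _. reflexivity.
    + intros s Hs. symmetry. now apply history_stype.
Qed.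

(** As a predicate, [good] depends only on the bits read so far; extensionality makes the predicates
    equal, and [epsilon] then chooses the same type. *)
Lemma history_local (p q : cantor) (n : nat) :
  agree n p q -> forall i, i <= S n -> history p i = history q i.
Proof.
  intros Ha. induction i as [|i IH]; intros Hi; simpl; auto.
  rewrite IH by lia. extensionality j.
  destruct (Nat.eqb_spec j i); auto. f_equal.
  extensionality r. apply propositional_extensionality.
  split; apply good_ext; auto; apply (agree_less i n); auto using agree_sym; lia.
Qed.

Lemma stype_local (p q : cantor) (n : nat) : agree n p q -> stype p n = stype q n.
Proof. intros Ha. unfold stype. now rewrite (history_local p q n Ha (S n)). Qed.

Lemma stype_ctype (p : cantor) (u : nat) : ctype (U p u) (stype p u).
Proof. apply (stype_good p u). Qed.

(** * The diagram and the limit type *)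

Definition atom_holds (p : cantor) (c : nat) : Prop :=
  exists r args, voc r = Some (length args) /\ c = code r args /\
    stype p (S c) (fRel r args).

Definition diagram (p : cantor) : cantor := fun c =>
  if excluded_middle_informative (atom_holds p c) then true else false.

Lemma diagram_true (p : cantor) (c : nat) : diagram p c = true <-> atom_holds p c.
Proof.
  unfold diagram. destruct excluded_middle_informative; split; auto; discriminate.
Qed.

Lemma diagram_continuous : continuous diagram.
Proof.
  intros p c. exists (S c). intros q Hq. unfold diagram, atom_holds.
  now rewrite (stype_local p q (S c) Hq).
Qed.

Lemma diagram_ModTau (p : cantor) : ModTau voc (diagram p).
Proof.
  intros c Hc. apply diagram_true in Hc. destruct Hc as [r [args [H1 [H2 _]]]]. eauto.
Qed.

(** A filter on stages, generated by late true stages of high level; it is proper because true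
    stages are unbounded at every level. *)
Definition eventually (p : cantor) (P : nat -> Prop) : Prop :=
  exists K N, forall s, N <= s -> tr K p s -> P s.

Lemma eventually_2 (p : cantor) (P P' Q : nat -> Prop) :
  (forall s, P s -> P' s -> Q s) -> eventually p P -> eventually p P' -> eventually p Q.
Proof.
  intros H [K [N E]] [K' [N' E']]. exists (max K K'), (max N N').
  intros s Hs Ht. apply H.
  - apply E; [lia|]. apply (strue_mono fam K (max K K')); auto. lia.
  - apply E'; [lia|]. apply (strue_mono fam K' (max K K')); auto. lia.
Qed.

Lemma eventually_impl (p : cantor) (P Q : nat -> Prop) :
  (forall s, P s -> Q s) -> eventually p P -> eventually p Q.
Proof. intros H [K [N E]]. exists K, N. auto. Qed.

Lemma eventually_frequent (p : cantor) (P : nat -> Prop) (K N : nat) :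
  eventually p P -> exists s, N <= s /\ tr K p s /\ P s.
Proof.
  intros [K' [N' E]]. destruct (strue_unbounded fam (max K K') p (max N N')) as [s [H1 H2]].
  exists s. split; [lia|]. split.
  - apply (strue_mono fam K (max K K')); auto. lia.
  - apply E; [lia|]. apply (strue_mono fam K' (max K K')); auto. lia.
Qed.

Definition limit (p : cantor) (phi : form) : Prop := eventually p (fun s => stype p s phi).

Lemma stype_stable (p : cantor) (k s t : nat) (phi : form) :
  wf voc phi -> low k phi -> below (len s) phi -> k <= s -> s <= t ->
  tr k p s -> tr k p t -> stype p s phi <-> stype p t phi.
Proof.
  intros W L B Hk Hst Hs Ht. destruct (Nat.eq_dec s t) as [->|Hne]; [tauto|].
  destruct (stype_good p t) as [_ [Hg _]]. apply (Hg k s); auto; [lia|].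
  now apply strue_chain.
Qed.

Lemma limit_at (p : cantor) (k s : nat) (phi : form) :
  wf voc phi -> low k phi -> below (len s) phi -> k <= s -> tr k p s ->
  limit p phi <-> stype p s phi.
Proof.
  intros W L B Hk Hs. split; intros H.
  - destruct (eventually_frequent p _ k s H) as [t [H1 [H2 H3]]].
    apply (stype_stable p k s t phi); auto.
  - exists k, s. intros t Hst Ht. apply (stype_stable p k s t phi); auto.
Qed.

Lemma limit_conseq (p : cantor) (a b : form) :
  (forall M v, sat M v a -> sat M v b) -> limit p a -> limit p b.
Proof.
  intros H. apply eventually_impl. intros s Ha.
  apply (ctype_conseq _ _ [a] _ (stype_ctype p s)).
  - intros c [<-|[]]; auto.
  - intros M v _ Hs. apply H, Hs. now left.
Qed.

Lemma limit_not (p : cantor) (a : form) : wf voc a -> limit p (fNot a) <-> ~ limit p a.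
Proof.
  intros W. split.
  - intros H1 H2.
    destruct (eventually_frequent p (fun _ => False) 0 0) as [s [_ [_ []]]].
    apply (eventually_2 p (fun s => stype p s (fNot a)) (fun s => stype p s a)); auto.
    intros s Hn Ha. now apply (ctype_not _ _ a (stype_ctype p s)) in Hn.
  - intros H. destruct (low_exists a) as [k Hk].
    exists k, (max k (vbound a)). intros s Hs Ht.
    apply (ctype_not _ _ _ (stype_ctype p s)). intros Ha. apply H.
    apply (limit_at p k s); auto; [|lia]. intros x Hx. apply free_vbound in Hx.
    pose proof (le_len s). lia.
Qed.

Lemma limit_and (p : cantor) (a b : form) :
  limit p (fAnd a b) <-> limit p a /\ limit p b.
Proof.
  split.
  - intros H. split; revert H; apply limit_conseq; simpl; tauto.
  - intros [Ha Hb].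
    apply (eventually_2 p (fun s => stype p s a) (fun s => stype p s b)); auto.
    intros s H1 H2. apply (ctype_conseq _ _ [a; b] _ (stype_ctype p s)).
    + intros c [<-|[<-|[]]]; auto.
    + intros M v _ Hs. split; apply Hs; simpl; auto.
Qed.

Lemma limit_ex (p : cantor) (x : nat) (a : form) : wf voc a ->
  limit p (fEx x a) <-> exists y, limit p (inst x y a).
Proof.
  intros W. split.
  - intros H. destruct (low_exists a) as [k Hk]. destruct (He (fEx x a)) as [n Hn].
    (* Past [n] the stage treats [e n]; past [vbound] by one, its variables were committed before
       the stage; past [k], the stage decides the instance for good. *)
    destruct (eventually_frequent p _ k (S (max (max k n) (vbound (fEx x a)))) H)
      as [s [H1 [H2 H3]]].
    assert (Hlen : forall t, pred s <= t -> below (len t) (fEx x a)).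
    { intros t Hts z Hz. apply free_vbound in Hz. pose proof (le_len t). lia. }
    destruct (stype_good p s) as [_ [_ [_ Hw]]].
    destruct (Hw n) with (x := x) (psi := a) as [y [Hy Hin]]; auto; try lia.
    + rewrite Hn. apply Hlen. lia.
    + now rewrite Hn.
    + exists y. apply (limit_at p k s); auto.
      * now apply wf_ren.
      * now apply low_ren.
      * apply below_inst; auto. apply Hlen. lia.
      * lia.
  - intros [y H]. revert H. apply limit_conseq. intros M v Hs. apply sat_inst in Hs.
    now exists (v y).
Qed.

Lemma limit_atom (p : cantor) (a : form) : wf voc a -> qf a -> forall s, vbound a <= s ->
  limit p a <-> stype p s a.
Proof.
  intros W Q s Hs. apply (limit_at p 0 s); auto; [now apply low_qf| |lia|exact I].
  intros x Hx. apply free_vbound in Hx. pose proof (le_len s). lia.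
Qed.

Lemma limit_eq (p : cantor) (i j : nat) : limit p (fEq i j) <-> i = j.
Proof.
  split.
  - intros H. apply NNPP. intros Hne.
    assert (D : forall i j, i < j -> ~ limit p (fEq i j)).
    { clear H Hne i j. intros i j Hij H. apply (limit_atom p (fEq i j) I I (S j)) in H.
      2: { unfold vbound. simpl. lia. }
      destruct (stype_good p (S j)) as [Hc [_ [Hd _]]].
      apply (ctype_not _ _ (fEq i j) Hc); auto. apply Hd; auto.
      pose proof (le_len (S j)). lia. }
    destruct (Nat.lt_gt_cases i j) as [Hl _]. destruct (Hl Hne) as [Hlt|Hlt].
    + now apply (D i j).
    + apply (D j i Hlt). revert H. apply limit_conseq. simpl. auto.
  - intros ->. exists 0, 0. intros s _ _.
    apply (ctype_conseq _ _ [] _ (stype_ctype p s)); [intros c []|]. intros; reflexivity.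
Qed.

Lemma limit_rel (p : cantor) (r : nat) (args : list nat) : voc r = Some (length args) ->
  limit p (fRel r args) <-> diagram p (code r args) = true.
Proof.
  intros W. rewrite diagram_true.
  rewrite (limit_atom p (fRel r args) W I (S (code r args))).
  - unfold atom_holds. split.
    + intros H. exists r, args. auto.
    + intros [r' [args' [_ [E H]]]]. apply code_inj in E. now destruct E as [-> ->].
  - unfold vbound. simpl. apply le_n_S. apply list_max_le. apply Forall_forall.
    intros x Hx. now apply le_code.
Qed.

Lemma limit_inst_ren (p : cantor) (x y : nat) (rho : nat -> nat) (a : form) :
  limit p (inst (fresh rho a) y (ren (upd rho x (fresh rho a)) a)) <->
  limit p (ren (upd rho x y) a).
Proof.
  assert (E : forall M v, sat M v (inst (fresh rho a) y (ren (upd rho x (fresh rho a)) a)) <->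
                     sat M v (ren (upd rho x y) a)).
  { intros M v. rewrite sat_inst, !sat_ren. apply sat_ext. intros z Hz.
    destruct (Nat.eq_dec z x) as [->|Hn].
    - now rewrite !upd_eq.
    - rewrite !(upd_neq rho) by auto. apply upd_neq. apply (free_fresh rho) in Hz. lia. }
  split; apply limit_conseq; intros M v; apply E.
Qed.

(** The elements are the variables themselves, so an assignment is a renaming, and the induction has
    to range over all of them. *)
Lemma truth (p : cantor) (phi : form) : wf voc phi -> forall rho,
  sat (struct_of (diagram p)) rho phi <-> limit p (ren rho phi).
Proof.
  induction phi; simpl; intros W rho.
  - symmetry. apply limit_eq.
  - symmetry. apply limit_rel. now rewrite length_map.
  - rewrite IHphi by auto. rewrite limit_not; [tauto|]. now apply wf_ren.
  - rewrite IHphi1, IHphi2, limit_and; tauto.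
  - destruct W as [W1 W2]. rewrite IHphi1, IHphi2 by auto.
    assert (E : limit p (fOr (ren rho phi1) (ren rho phi2)) <->
      limit p (fNot (fAnd (fNot (ren rho phi1)) (fNot (ren rho phi2))))).
    { split; apply limit_conseq; simpl; intros; tauto. }
    rewrite E, limit_not, limit_and, !limit_not; simpl; rewrite ?wf_ren; auto. tauto.
  - rewrite limit_ex by now apply wf_ren.
    split; intros [d Hd]; exists d; revert Hd; rewrite limit_inst_ren; now apply IHphi.
  - set (N := fresh rho phi). set (b := ren (upd rho n N) phi).
    assert (E : limit p (fAll N b) <-> limit p (fNot (fEx N (fNot b)))).
    { split; apply limit_conseq; simpl; intros M v H.
      - intros [d Hd]. auto.
      - intros d. apply NNPP. intros Hd. eauto. }
    assert (Wb : wf voc b) by now apply wf_ren.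
    assert (Ei : forall d, limit p (inst N d (fNot b)) <->
      ~ sat (struct_of (diagram p)) (upd rho n d) phi).
    { intros d. change (inst N d (fNot b)) with (fNot (inst N d b)).
      rewrite limit_not by now apply wf_ren. unfold b, N.
      rewrite limit_inst_ren, IHphi; tauto. }
    rewrite E, limit_not, limit_ex by auto. split.
    + intros H [d Hd]. now apply (proj1 (Ei d) Hd).
    + intros H d. apply NNPP. intros Hd. apply H. exists d. now apply Ei.
Qed.

(** The hypothesis covers both outcomes: inside [P] the guesses may keep changing and only contain
    ever larger exists_k parts of [T], outside they become constant along true stages. *)
Lemma diagram_model (p : cantor) (W : form -> Prop) : complete_theory voc W ->
  (forall k N, exists s, N <= s /\ tr k p s /\ forall phi, ExF k phi -> W phi -> U p s phi) ->
  model (struct_of (diagram p)) W.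
Proof.
  intros HW H. split; [exact (inhabits 0)|]. intros phi Hphi v.
  destruct (proj1 HW phi Hphi) as [Wf Fr].
  destruct (low_exists phi) as [k [psi [L [Wpsi [Fpsi Spsi]]]]].
  assert (Sp : sentence voc psi) by (split; auto; intros x Hx; now apply (Fr x), Fpsi).
  assert (Hpsi : W psi).
  { apply (proj2 (proj2 (proj2 HW))); auto. intros M HM w. apply Spsi. now apply HM. }
  apply truth; auto. destruct (H k k) as [s [H1 [H2 H3]]].
  apply (limit_at p k s); auto.
  - now apply wf_ren.
  - apply low_ren. exists psi. split; auto. now repeat split; auto; apply Spsi.
  - intros x Hx. apply free_ren in Hx. destruct Hx as [y [Hy _]]. now apply Fr in Hy.
  - apply (ctype_equiv (U p s) _ psi).
    + apply stype_ctype.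
    + intros M w. rewrite sat_ren, Spsi. apply sat_ext. intros x Hx. now apply Fr in Hx.
    + apply (ctype_sentence voc (U p s)); auto. apply stype_ctype.
Qed.

End Construction.

(** * Complexity of the set of models *)

(** Closure under negation lets one invariant carry the induction on formulas; only finiteness of
    the level matters, so connectives may waste levels. *)
Definition Delta (n : nat) (A : cantor -> Prop) : Prop :=
  Sigma n A /\ Sigma n (fun x => ~ A x).

Lemma Sigma_S (n : nat) (A : cantor -> Prop) : Sigma n A -> Sigma (S n) A.
Proof.
  revert A. induction n as [|[|n] IH]; intros A HA.
  - destruct HA.
  (* An open set is the union over [k] of the clopen sets of points whose [k]-th neighbourhood it
     contains. *)
  - exists (fun k x => forall q, agree k x q -> A q). split.
    + intros k x Hx. exists k. intros y Hy Hc. apply Hx. intros q Hq. apply Hc.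
      apply (agree_trans k y x q); auto. now apply agree_sym.
    + intros x. split.
      * intros Hx. destruct (HA x Hx) as [k Hk]. eauto.
      * intros [k Hk]. apply Hk. intros i _. reflexivity.
  - destruct HA as [B [H1 H2]]. exists B. split; auto.
Qed.

Lemma Delta_mono (m n : nat) (A : cantor -> Prop) : m <= n -> Delta m A -> Delta n A.
Proof. induction 1; auto. intros H1. destruct (IHle H1). split; now apply Sigma_S. Qed.

Lemma Delta_iff (n : nat) (A B : cantor -> Prop) :
  (forall x, A x <-> B x) -> Delta n A -> Delta n B.
Proof.
  intros H [H1 H2]. split.
  - now apply (Sigma_iff n A).
  - apply (Sigma_iff n (fun x => ~ A x)); auto. intros x. rewrite H. tauto.
Qed.

Lemma Delta_not (n : nat) (A : cantor -> Prop) : Delta n A -> Delta n (fun x => ~ A x).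
Proof.
  intros [H1 H2]. split; auto. apply (Sigma_iff n A); auto. intros x. tauto.
Qed.

Lemma Delta_ex (n : nat) (B : nat -> cantor -> Prop) :
  (forall k, Delta n (B k)) -> Delta (S (S n)) (fun x => exists k, B k x).
Proof.
  destruct n as [|n]; [intros H; destruct (H 0) as [[] _]|]. intros H.
  assert (E : Sigma (S (S n)) (fun x => exists k, B k x)).
  { exists B. split; [intros k; apply H | tauto]. }
  split; [now apply Sigma_S|].
  exists (fun _ x => ~ exists k, B k x). split.
  - intros _. apply (Sigma_iff _ (fun x => exists k, B k x)); auto. intros x. tauto.
  - intros x. split; [intros Hx; now exists 0 | now intros [_ Hx]].
Qed.

Lemma Delta_or (n : nat) (A B : cantor -> Prop) :
  Delta n A -> Delta n B -> Delta (S (S n)) (fun x => A x \/ B x).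
Proof.
  intros HA HB.
  apply (Delta_iff _ (fun x => exists k, match k with 0 => A x | _ => B x end)).
  - intros x. split.
    + intros [[|k] H]; auto.
    + intros [H|H]; [now exists 0 | now exists 1].
  - apply (Delta_ex n (fun k x => match k with 0 => A x | _ => B x end)).
    now intros [|k].
Qed.

Lemma Delta_and (n : nat) (A B : cantor -> Prop) :
  Delta n A -> Delta n B -> Delta (S (S n)) (fun x => A x /\ B x).
Proof.
  intros HA HB. apply (Delta_iff _ (fun x => ~ (~ A x \/ ~ B x))).
  - intros x. tauto.
  - apply Delta_not, Delta_or; now apply Delta_not.
Qed.

Lemma Delta_const (Q : Prop) : Delta 1 (fun _ => Q).
Proof. split; intros p Hp; exists 0; auto. Qed.

Lemma Delta_bit (c : nat) : Delta 1 (fun p => p c = true).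
Proof.
  split; intros p Hp; exists (S c); intros q Hq; [rewrite <- (Hq c)| rewrite <- (Hq c)]; auto.
Qed.

Lemma Delta_sat (phi : form) : exists n, forall v : nat -> nat,
  Delta n (fun p => sat (struct_of p) v phi).
Proof.
  assert (X : forall x a, (exists n, forall v : nat -> nat,
                Delta n (fun p => sat (struct_of p) v a)) ->
              exists n, forall v : nat -> nat, Delta n (fun p => sat (struct_of p) v (fEx x a))).
  { intros x a [n H]. exists (S (S n)). intros v.
    apply (Delta_ex n (fun d p => sat (struct_of p) (upd v x d) a)). auto. }
  induction phi.
  - exists 1. intros v. apply (Delta_const (v n = v n0)).
  - exists 1. intros v. apply (Delta_bit (code n (map v l))).
  - destruct IHphi as [n H]. exists n. intros v. now apply Delta_not.
  - destruct IHphi1 as [m H1], IHphi2 as [n H2]. exists (S (S (max m n))). intros v.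
    apply Delta_and; [apply (Delta_mono m) | apply (Delta_mono n)]; auto; lia.
  - destruct IHphi1 as [m H1], IHphi2 as [n H2]. exists (S (S (max m n))). intros v.
    apply Delta_or; [apply (Delta_mono m) | apply (Delta_mono n)]; auto; lia.
  - auto.
  - destruct (X n (fNot phi)) as [m H].
    { destruct IHphi as [m H]. exists m. intros v. now apply Delta_not. }
    exists m. intros v. apply (Delta_iff m (fun p => ~ sat (struct_of p) v (fEx n (fNot phi)))).
    + intros p. simpl. split.
      * intros N d. apply NNPP. intros Hd. eauto.
      * intros A [d Hd]. auto.
    + now apply Delta_not.
Qed.

Lemma ModT_PiOmega (voc : vocabulary) (T : form -> Prop) :
  complete_theory voc T -> PiOmega (ModT voc T).
Proof.
  intros HT. destruct form_enumeration as [e He].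
  (* Members of [T] are sentences, so the constant assignment 0 tests them. *)
  set (B := fun c p =>
    (p c = true -> exists r args, voc r = Some (length args) /\ c = code r args) /\
    (T (e c) -> sat (struct_of p) (fun _ => 0) (e c))).
  assert (HB : forall c, exists n, Delta n (B c)).
  { intros c. destruct (Delta_sat (e c)) as [n Hn].
    assert (I : forall (P A : cantor -> Prop) m, Delta m P -> Delta m A ->
              Delta (S (S m)) (fun p => P p -> A p)).
    { intros P A m HP HA. apply (Delta_iff _ (fun p => ~ P p \/ A p)).
      - intros p. tauto.
      - apply Delta_or; auto. now apply Delta_not. }
    assert (C : forall Q, Delta (S n) (fun _ => Q)).
    { intros Q. apply (Delta_mono 1); [lia|]. apply Delta_const. }
    exists (S (S (S (S (S n))))). apply Delta_and; apply I; auto.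
    - apply (Delta_mono 1); [lia|]. apply Delta_bit.
    - apply (Delta_mono n); auto. }
  destruct (choice _ HB) as [lev Hlev].
  exists B, lev. split; [intros k; apply Hlev|].
  intros p. split.
  - intros [H1 [_ H2]] c. split; [apply H1|]. intros H. now apply H2.
  - intros H. split; [intros c; apply H|]. split; [exact (inhabits 0)|].
    intros phi Hphi v. destruct (He phi) as [c <-].
    apply (sat_ext (struct_of p) (e c) (fun _ => 0)); [|now apply H].
    intros x Hx. destruct (proj2 (proj1 HT _ Hphi) x Hx).
Qed.

Theorem theorem3p3 (voc : vocabulary) (T : form -> Prop)
  (Ts : nat -> form -> Prop)
  (hT : complete_theory voc T) (hTinf : has_infinite_model T)
  (hTs : forall n, complete_theory voc (Ts n))
  (hTsinf : forall n, has_infinite_model (Ts n))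
  (hneq : forall n, ~ (forall phi, T phi <-> Ts n phi))
  (hagree : forall n phi, ExF n phi -> (T phi <-> Ts n phi)) :
  PiOmega_complete (ModT voc T) /\
  (forall P : cantor -> Prop, PiOmega P ->
     exists f : cantor -> cantor,
       continuous f /\
       (forall p, ModTau voc (f p)) /\
       (forall p, P p -> model (struct_of (f p)) T) /\
       (forall p, ~ P p -> exists n, model (struct_of (f p)) (Ts n))).
Proof.
  assert (main : forall P : cantor -> Prop, PiOmega P ->
     exists f : cantor -> cantor,
       continuous f /\
       (forall p, ModTau voc (f p)) /\
       (forall p, P p -> model (struct_of (f p)) T) /\
       (forall p, ~ P p -> exists n, model (struct_of (f p)) (Ts n))).
  { intros P HP. destruct (PiOmega_open_compl P HP) as [fam [B [lev [HPB HB]]]].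
    destruct form_enumeration as [e He].
    set (U := guess fam B lev T Ts).
    assert (HU : forall p u, complete_theory voc (U p u) /\ has_infinite_model (U p u)).
    { intros p u. unfold U.
      destruct (guess_cases fam B lev T Ts p u) as [[s [_ ->]]|[_ ->]]; auto. }
    assert (HUc := fun p u => proj1 (HU p u)). assert (HUinf := fun p u => proj2 (HU p u)).
    assert (HUloc := guess_local fam B lev T Ts : forall p q u, agree u p q -> U p u = U q u).
    assert (HUag : forall p j s u phi, sle fam j p s u -> j <= s -> ExF (S j) phi ->
              U p s phi <-> U p u phi).
    { intros. now apply (guess_agree fam B lev T Ts hagree p j). }
    exists (diagram voc fam U e). split; [|split; [|split]].
    - now apply diagram_continuous.
    - apply diagram_ModTau.
    - intros p Hp. apply diagram_model; auto. intros k N.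
      destruct (strue_unbounded fam k p N) as [s [H1 H2]]. exists s. split; auto.
      split; auto. intros phi Hphi H.
      apply (guess_in fam B lev T Ts hagree p k s); auto. now apply HPB.
    - intros p Hp. rewrite HPB in Hp.
      destruct (guess_out fam B lev T Ts HB p Hp) as [c [m Hc]]. exists (S c).
      apply diagram_model; auto. intros k N.
      destruct (strue_unbounded fam (max k m) p (max N m)) as [s [H1 H2]].
      exists s. split; [lia|]. split; [apply (strue_mono fam k (max k m)); auto; lia|].
      intros phi _ H. unfold U. rewrite Hc; auto; [lia|].
      apply (strue_mono fam m (max k m)); auto. lia. }
  split; [|exact main]. split; [now apply ModT_PiOmega|].
  intros P HP. destruct (main P HP) as [f [H1 [H2 [H3 H4]]]]. exists f. split; auto.
  intros p. split; [split; auto|]. intros [_ HM]. apply NNPP. intros N.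
  destruct (H4 p N) as [n Hn]. apply (hneq n).
  (* Complete theories with a common model coincide, so a model of [T] over an input outside [P]
     would contradict [hneq]. *)
  assert (E : forall S S' : form -> Prop, complete_theory voc S -> complete_theory voc S' ->
            model (struct_of (f p)) S -> model (struct_of (f p)) S' ->
            forall phi, S phi -> S' phi).
  { intros S S' HS HS' M M' phi Hphi.
    destruct (proj1 (proj2 (proj2 HS')) phi (proj1 HS phi Hphi)) as [|Hn']; auto.
    destruct (proj2 M' _ Hn' (fun _ => 0)). now apply M. }
  intros phi. split; [apply (E T (Ts n)) | apply (E (Ts n) T)]; auto.
Qed.
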